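(* Assume that: (i) $V_1\subseteq V_2$ are transitive models of $ZFC$, and $V_1$ is a class of $V_2$ containing all ordinals. (ii) $V_1\models$ ''$\kappa$ is regular $>\aleph_0$''. (iii) $V_2\models$ ''$\mathrm{cf}(\kappa)=\theta$, $\kappa$ is a cardinal and $\theta<\kappa$''. Moreover, assume that one of the following two alternatives holds. EITHER $\theta>\aleph_0$ and: (iv$'$) if $a\in V_2$ is such that $V_2\models$ ''$|a|\le\mathrm{cf}(\mathrm{Club}^{V_2}(\theta),\supseteq)$'' and $V_2\models$ ''$a\subseteq\mathrm{Club}^{V_1}(\kappa)$'', then there is a sequence $\langle b_i:i<\theta\rangle\in V_2$ such that for all $i<\theta$, $b_i\in V_1$ and $V_1\models$ ''$|b_i|\le\kappa$'', and $V_2\models$ ''$a\subseteq\bigcup_{i<\theta}b_i$''. OR $\theta=\aleph_0$ and: (iv$''$) $V_2\models$ ''$2^{\aleph_0}<\kappa$''; (v$''$) for every $a\subseteq\mathrm{Club}^{V_1}(\kappa)$ (in $V_2$) such that $|a|^{V_2}\le 2^\theta$, there is a $b\in V_1$ such that $a\subseteq b$ and $|b|^{V_1}\le\kappa$. Then in $V_2$ we can find an unbounded $C^\ast\subseteq\kappa$ such that $$E\in\mathrm{Club}^{V_1}(\kappa)\implies C^\ast\setminus E\text{ is bounded (in }\kappa).$$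
   Context: $\mathrm{Club}(\kappa)$ is the club filter on $\kappa$; superscripts $V_1,V_2$ indicate the universe in which a notion is computed. $\mathrm{cf}(\mathrm{Club}(\theta),\supseteq)$ is the least cardinality of a family $\mathcal F\subseteq\mathrm{Club}(\theta)$ such that every member of $\mathrm{Club}(\theta)$ includes a member of $\mathcal F$. Notions for which no universe is specified are computed in $V_2$. *)

(* Defs.v *)
From Stdlib Require Import Wellfounded.

Set Implicit Arguments.
Unset Strict Implicit.
Unset Printing Implicit Defensive.

(** Models of set theory are transitive classes [M : U -> Prop] of a universe
    [U] with an extensional and well-founded membership relation.  By
    Mostowski's theorem every well-founded extensional structure is isomorphic
    to a transitive one, so nothing else is required of [U]; in particular a
    class may be all of [U].

    A notion depending on the model in which it is computed takes the class [M]
    as an argument and restricts its unbounded quantifiers to [M].  The notions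
    without such an argument are Delta_0, hence have the same meaning in [U] and
    in every transitive model of ZFC containing their arguments. *)

Record universe : Type := Universe {
  carrier :> Type;
  mem : carrier -> carrier -> Prop;
  mem_ext : forall x y, (forall z, mem z x <-> mem z y) -> x = y;
  mem_wf : well_founded mem
}.
Arguments mem {u} _ _.

Notation "x ∈ y" := (mem x y) (at level 70, no associativity).
Notation "x ∉ y" := (~ mem x y) (at level 70, no associativity).

Definition subset {U : universe} (x y : U) : Prop := forall z, z ∈ x -> z ∈ y.
Notation "x ⊆ y" := (subset x y) (at level 70, no associativity).

Definition transitive_class {U : universe} (M : U -> Prop) : Prop :=
  forall x y, M y -> x ∈ y -> M x.

(** * First-order satisfaction *)

(* de Bruijn indices: index 0 refers to the innermost quantifier. *)
Inductive formula : Type :=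
| FMem (i j : nat)
| FEq (i j : nat)
| FNot (p : formula)
| FAnd (p q : formula)
| FAll (p : formula).

Definition scons {T : Type} (x : T) (e : nat -> T) (n : nat) : T :=
  match n with O => x | S m => e m end.

Fixpoint sat {U : universe} (M : U -> Prop) (e : nat -> U) (p : formula) : Prop :=
  match p with
  | FMem i j => e i ∈ e j
  | FEq i j => e i = e j
  | FNot p => ~ sat M e p
  | FAnd p q => sat M e p /\ sat M e q
  | FAll p => forall x, M x -> sat M (scons x e) p
  end.

Record ZFC {U : universe} (M : U -> Prop) : Prop := {
  zfc_extensionality : forall x y, M x -> M y ->
    (forall z, M z -> (z ∈ x <-> z ∈ y)) -> x = y;
  zfc_foundation : forall x, M x -> (exists y, M y /\ y ∈ x) ->
    exists y, M y /\ y ∈ x /\ ~ exists z, M z /\ z ∈ y /\ z ∈ x;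
  zfc_pairing : forall x y, M x -> M y ->
    exists p, M p /\ forall z, M z -> (z ∈ p <-> z = x \/ z = y);
  zfc_union : forall x, M x ->
    exists u, M u /\ forall z, M z -> (z ∈ u <-> exists y, M y /\ y ∈ x /\ z ∈ y);
  zfc_powerset : forall x, M x ->
    exists p, M p /\
      forall y, M y -> (y ∈ p <-> forall z, M z -> z ∈ y -> z ∈ x);
  zfc_infinity : exists w, M w /\
    (exists z, M z /\ z ∈ w /\ forall t, M t -> t ∉ z) /\
    (forall x, M x -> x ∈ w ->
      exists y, M y /\ y ∈ w /\ forall t, M t -> (t ∈ y <-> t ∈ x \/ t = x));
  zfc_separation : forall (p : formula) (e : nat -> U), (forall n, M (e n)) ->
    forall a, M a ->
    exists b, M b /\
      forall x, M x -> (x ∈ b <-> x ∈ a /\ sat M (scons x e) p);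
  zfc_replacement : forall (p : formula) (e : nat -> U), (forall n, M (e n)) ->
    forall a, M a ->
    (forall x y y', M x -> M y -> M y' -> x ∈ a ->
      sat M (scons x (scons y e)) p -> sat M (scons x (scons y' e)) p -> y = y') ->
    exists b, M b /\
      forall y, M y ->
        (y ∈ b <-> exists x, M x /\ x ∈ a /\ sat M (scons x (scons y e)) p);
  zfc_choice : forall f, M f ->
    (forall x, M x -> x ∈ f -> exists z, M z /\ z ∈ x) ->
    (forall x y z, M x -> M y -> M z ->
      x ∈ f -> y ∈ f -> z ∈ x -> z ∈ y -> x = y) ->
    exists c, M c /\
      forall x, M x -> x ∈ f -> exists! z, M z /\ z ∈ x /\ z ∈ c
}.

(* A class of [V2] is a collection definable over [V2] with parameters in [V2]. *)
Definition class_of {U : universe} (V2 V1 : U -> Prop) : Prop :=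
  (forall x, V1 x -> V2 x) /\
  exists (p : formula) (e : nat -> U), (forall n, V2 (e n)) /\
    forall x, V2 x -> (V1 x <-> sat V2 (scons x e) p).

(** * Absolute notions *)

Definition transitive_set {U : universe} (x : U) : Prop :=
  forall y, y ∈ x -> y ⊆ x.

(* Membership being well-founded, trichotomy makes it a well-order of [x]. *)
Definition ordinal {U : universe} (x : U) : Prop :=
  transitive_set x /\
  forall y z, y ∈ x -> z ∈ x -> y ∈ z \/ y = z \/ z ∈ y.

Definition limit_ordinal {U : universe} (x : U) : Prop :=
  ordinal x /\ (exists y, y ∈ x) /\ forall y, y ∈ x -> exists z, z ∈ x /\ y ∈ z.

(* omega, that is aleph_0: the least limit ordinal *)
Definition is_omega {U : universe} (w : U) : Prop :=
  limit_ordinal w /\ forall n, n ∈ w -> ~ limit_ordinal n.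

Definition gt_aleph0 {U : universe} (x : U) : Prop :=
  exists w, is_omega w /\ w ∈ x.

Definition is_upair {U : universe} (p x y : U) : Prop :=
  forall z, z ∈ p <-> z = x \/ z = y.

Definition is_pair {U : universe} (p x y : U) : Prop :=
  exists u v, is_upair u x x /\ is_upair v x y /\ is_upair p u v.

Definition app {U : universe} (f x y : U) : Prop :=
  exists p, p ∈ f /\ is_pair p x y.

Definition function_on {U : universe} (f a : U) : Prop :=
  (forall p, p ∈ f -> exists x y, x ∈ a /\ is_pair p x y) /\
  (forall x, x ∈ a -> exists! y, app f x y).

Definition map {U : universe} (f a b : U) : Prop :=
  function_on f a /\ forall x y, app f x y -> y ∈ b.

Definition injection {U : universe} (f a b : U) : Prop :=
  map f a b /\ forall x x' y, app f x y -> app f x' y -> x = x'.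

Definition bijection {U : universe} (f a b : U) : Prop :=
  injection f a b /\ forall y, y ∈ b -> exists x, app f x y.

(* For sets of ordinals below [k]; [y ∉ x] says [x <= y]. *)
Definition unbounded {U : universe} (k : U) (P : U -> Prop) : Prop :=
  forall x, x ∈ k -> exists y, P y /\ y ∉ x.

Definition bounded {U : universe} (k : U) (P : U -> Prop) : Prop :=
  exists x, x ∈ k /\ forall y, P y -> y ∈ x.

Definition closed {U : universe} (k c : U) : Prop :=
  forall d, d ∈ k -> limit_ordinal d ->
    unbounded d (fun x => x ∈ c /\ x ∈ d) -> d ∈ c.

Definition club {U : universe} (k c : U) : Prop :=
  c ⊆ k /\ unbounded k (fun x => x ∈ c) /\ closed k c.

(** * Notions computed in a class *)

(* |a| <= |b| *)
Definition card_le {U : universe} (M : U -> Prop) (a b : U) : Prop :=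
  exists f, M f /\ injection f a b.

Definition equinumerous {U : universe} (M : U -> Prop) (a b : U) : Prop :=
  exists f, M f /\ bijection f a b.

Definition cardinal {U : universe} (M : U -> Prop) (k : U) : Prop :=
  ordinal k /\ forall x, x ∈ k -> ~ equinumerous M x k.

Definition cardinality {U : universe} (M : U -> Prop) (a k : U) : Prop :=
  cardinal M k /\ equinumerous M a k.

Definition cofinal_map {U : universe} (f t k : U) : Prop :=
  map f t k /\ unbounded k (fun y => exists x, app f x y).

Definition cofinality {U : universe} (M : U -> Prop) (k t : U) : Prop :=
  ordinal k /\ ordinal t /\
  (exists f, M f /\ cofinal_map f t k) /\
  (forall s, s ∈ t -> ~ exists f, M f /\ cofinal_map f s k).

(* A cardinal is infinite iff it is a limit ordinal. *)
Definition regular {U : universe} (M : U -> Prop) (k : U) : Prop :=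
  cardinal M k /\ limit_ordinal k /\ cofinality M k k.

(* [m] is 2^|x|, the cardinality of the power set of [x] *)
Definition two_power {U : universe} (M : U -> Prop) (x m : U) : Prop :=
  exists p, M p /\ (forall y, M y -> (y ∈ p <-> y ⊆ x)) /\ cardinality M p m.

(* [a] belongs to the filter on [k] generated by the closed unbounded sets *)
Definition Club {U : universe} (M : U -> Prop) (k a : U) : Prop :=
  M a /\ a ⊆ k /\ exists c, M c /\ club k c /\ c ⊆ a.

Definition Club_base {U : universe} (M : U -> Prop) (k F : U) : Prop :=
  (forall a, a ∈ F -> Club M k a) /\
  (forall a, Club M k a -> exists b, b ∈ F /\ b ⊆ a).

(* [m] is cf(Club([k]), ⊇) *)
Definition cf_Club {U : universe} (M : U -> Prop) (k m : U) : Prop :=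
  (exists F, M F /\ Club_base M k F /\ cardinality M F m) /\
  (forall F n, M F -> M n -> Club_base M k F -> cardinality M F n -> n ∉ m).

(* Main.v *)
(** Let K be the set of clubs of kappa in V1; it belongs to V2.  A set b in V1
    with at most kappa elements has a diagonal intersection in V1, a club that is
    almost contained (that is, up to a bounded set) in every member of b in K.

    Suppose theta > aleph_0, and let (k_j : j < theta) be continuous and cofinal
    in kappa.  If no {k_j : j in e}, with e in a base of Club(theta), is as wanted,
    choose a bad E(e) in K for each e.  By (iv') these are covered by theta many
    sets b_i; let E_i be an almost lower bound of b_i.  Then {j : k_j in E_i for
    all i < j} is a club of theta, so it includes some e of the base, and
    {k_j : j in e} is almost contained in each E_i, hence in E(e).

    Suppose theta = aleph_0, and that each unbounded C has a bad E(C) in K.  Let X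
    be the least subset of kappa that contains a cofinal sequence (k_n) and, with
    each countable C included in X and each a in C, the ordinal sup(E(C) /\ a).
    It has size at most 2^aleph_0, so by (v'') some E* in K is almost contained in
    E(C) for all countable C included in X.  Let f(n) be the least element of X
    that is >= some g_n >= k_n in E*, and let C = {f(n) : n}.  If f(n) is large
    enough, then g_n is in E(C), and so is f(n): otherwise f(n) = sup(E(C) /\ f(n))
    by minimality, and E(C) is closed.  So E(C) is not bad for C. *)

Require Import Defs.
From Stdlib Require Import Arith Lia Classical ClassicalEpsilon FunctionalExtensionality.

(** Separation and replacement are available only for formulas with parameters, and two models are
    in play. So sets are formed from predicates that are shown to be [definable] over the model; a
    calculus of definable predicates and terms, with automation, yields these proofs, and definable
    Rocq functions stand in for set functions. All of this is developed for one arbitrary transitive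
    model [M]. It is applied to V1 to form diagonal intersections, and to V2, where both cases treat
    the set of V1-clubs as a mere parameter. One diagonal lemma serves both models: along the
    identity of kappa in V1, along the sequence k_j in V2. In the countable case the obstacle is the
    size of the closure X and of the family of its countable subsets. Each element of X gets codes
    in P(omega), built so that a code has only one value, and a sequence of codes folds into one
    code by a pairing function. Hence the countable subsets of X are themselves indexed by P(omega),
    and (v'') is applied to a family with that index set, without cardinal arithmetic. *)

Section Renaming.

Context {U : universe} (M : U -> Prop).

Fixpoint rename (f : nat -> nat) (p : formula) : formula :=
  match p with
  | FMem i j => FMem (f i) (f j)
  | FEq i j => FEq (f i) (f j)
  | FNot p => FNot (rename f p)
  | FAnd p q => FAnd (rename f p) (rename f q)
  | FAll p => FAll (rename (scons 0 (fun n => S (f n))) p)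
  end.

Lemma sat_rename p : forall f (e : nat -> U),
  sat M e (rename f p) <-> sat M (fun n => e (f n)) p.
Proof.
induction p as [i j|i j|p IH|p IHp q IHq|p IH]; intros f e; simpl; try tauto.
- rewrite IH; tauto.
- rewrite IHp, IHq; tauto.
- assert (E : forall x, (fun n => scons x e (scons 0 (fun n => S (f n)) n))
                        = scons x (fun n => e (f n))).
  { intros x; apply functional_extensionality; intros [|n]; reflexivity. }
  split; intros H x Mx; specialize (H x Mx); rewrite IH, E in *; exact H.
Qed.

End Renaming.

Section Model.

Context {U : universe} {M : U -> Prop}.
Hypothesis M_trans : transitive_class M.
Hypothesis M_zfc : ZFC M.

(** * Definability with parameters *)

Definition in_model (e : nat -> U) : Prop := forall n, M (e n).

(* Variables are at the even indices, parameters at the odd ones. *)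
Definition merge (e r : nat -> U) (n : nat) : U :=
  if Nat.even n then e (Nat.div2 n) else r (Nat.div2 n).

Lemma merge_var e r n : merge e r (2 * n) = e n.
Proof.
unfold merge. rewrite Nat.even_mul; simpl Nat.even; simpl orb.
now rewrite Nat.div2_double.
Qed.

Lemma merge_par e r n : merge e r (S (2 * n)) = r n.
Proof.
unfold merge.
replace (Nat.even (S (2 * n))) with false.
- now rewrite Nat.div2_succ_double.
- rewrite Nat.even_succ, Nat.odd_mul; reflexivity.
Qed.

Lemma index_split n : exists k, n = 2 * k \/ n = S (2 * k).
Proof. exists (Nat.div2 n). pose proof (Nat.div2_odd n). destruct (Nat.odd n); simpl in *; lia. Qed.

Lemma merge_in e r : in_model e -> in_model r -> in_model (merge e r).
Proof. intros He Hr n; unfold merge; destruct (Nat.even n); auto. Qed.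

(** [P] is an arbitrary Rocq predicate, whose quantifiers may range over all of [U]; agreement with
    the formula is asked only for assignments in [M]. Hiding the parameters [r] lets connectives
    combine predicates without tracking them. *)
Definition definable (P : (nat -> U) -> Prop) : Prop :=
  exists p r, in_model r /\ forall e, in_model e -> (P e <-> sat M (merge e r) p).

(** Definability of the graph: the value sits at index 0, so the arguments are shifted by one. *)
Definition definable_term (t : (nat -> U) -> U) : Prop :=
  (forall e, in_model e -> M (t e)) /\ definable (fun e => e 0 = t (fun n => e (S n))).

Lemma definable_ext P Q : (forall e, in_model e -> (P e <-> Q e)) ->
  definable P -> definable Q.
Proof.
intros H (p & r & Hr & E); exists p, r; split; [exact Hr|].
intros e He; rewrite <- H by exact He; auto.
Qed.

Lemma model_nonempty : exists x, M x.
Proof. destruct (zfc_infinity M_zfc) as (w & Mw & _); eauto. Qed.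

Lemma definable_rename f P : definable P -> definable (fun e => P (fun n => e (f n))).
Proof.
intros (p & r & Hr & E).
exists (rename (fun n => if Nat.even n then 2 * f (Nat.div2 n) else n) p), r.
split; [exact Hr|]; intros e He.
rewrite E by (intros n; apply He); rewrite sat_rename.
match goal with |- sat _ ?a _ <-> sat _ ?b _ => replace b with a; [tauto|] end.
apply functional_extensionality; intros n; unfold merge at 1.
destruct (Nat.even n) eqn:Hn; [now rewrite merge_var|].
unfold merge; now rewrite Hn.
Qed.

Lemma definable_not P : definable P -> definable (fun e => ~ P e).
Proof.
intros (p & r & Hr & E); exists (FNot p), r; split; [exact Hr|].
intros e He; simpl; rewrite E; tauto.
Qed.

Lemma definable_and P Q : definable P -> definable Q -> definable (fun e => P e /\ Q e).
Proof.
intros (p & r & Hr & Ep) (q & s & Hs & Eq).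
(* The two parameter lists are interleaved: parameter k of [p] moves to place 2k of [merge r s],
   parameter k of [q] to place 2k + 1. *)
pose (fp := fun n => if Nat.even n then n else S (2 * (2 * Nat.div2 n))).
pose (fq := fun n => if Nat.even n then n else S (2 * (S (2 * Nat.div2 n)))).
exists (FAnd (rename fp p) (rename fq q)), (merge r s).
split; [now apply merge_in|]; intros e He; simpl.
rewrite !sat_rename, Ep, Eq by exact He.
assert (Hp : (fun n => merge e (merge r s) (fp n)) = merge e r).
{ apply functional_extensionality; intros n; unfold fp.
  destruct (index_split n) as (k & [-> | ->]); [rewrite Nat.even_mul; simpl Nat.even at 1; simpl orb|].
  - cbv iota; now rewrite !merge_var.
  - rewrite Nat.even_succ, Nat.odd_mul; simpl Nat.odd at 1; simpl andb; cbv iota.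
    rewrite Nat.div2_succ_double, merge_par, merge_var, merge_par; reflexivity. }
assert (Hq : (fun n => merge e (merge r s) (fq n)) = merge e s).
{ apply functional_extensionality; intros n; unfold fq.
  destruct (index_split n) as (k & [-> | ->]); [rewrite Nat.even_mul; simpl Nat.even at 1; simpl orb|].
  - cbv iota; now rewrite !merge_var.
  - rewrite Nat.even_succ, Nat.odd_mul; simpl Nat.odd at 1; simpl andb; cbv iota.
    rewrite Nat.div2_succ_double, !merge_par; reflexivity. }
rewrite Hp, Hq; tauto.
Qed.

Lemma in_model_scons x e : M x -> in_model e -> in_model (scons x e).
Proof. intros Mx He [|n]; simpl; auto. Qed.

Lemma definable_all P : definable (fun e => P (e 0) (fun n => e (S n))) ->
  definable (fun e => forall x, M x -> P x e).
Proof.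
intros (p & r & Hr & E).
(* Variable 0 becomes the one bound by [FAll]; variable k + 1 becomes variable k of [e], and every
   index of the outer assignment is raised by one under the binder. *)
pose (f := fun n => if Nat.even n then
   match Nat.div2 n with 0 => 0 | S k => S (2 * k) end else S n).
exists (FAll (rename f p)), r; split; [exact Hr|]; intros e He; simpl.
assert (H : forall x, (fun n => scons x (merge e r) (f n)) = merge (scons x e) r).
{ intros x; apply functional_extensionality; intros n; unfold f, merge at 2.
  destruct (Nat.even n) eqn:Hn.
  - destruct (Nat.div2 n) as [|k]; [reflexivity|].
    change (merge e r (2 * k) = e k); apply merge_var.
  - simpl; unfold merge; now rewrite Hn. }
split; intros HA x Mx; specialize (HA x Mx).
- rewrite sat_rename, H; apply (E (scons x e)); [now apply in_model_scons|exact HA].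
- rewrite sat_rename, H in HA; apply (E (scons x e)) in HA; [exact HA|now apply in_model_scons].
Qed.

(** Excluded middle chooses between a valid and a contradictory formula, so a statement independent
    of the assignment is definable however it is phrased. *)
Lemma definable_prop (A : Prop) : definable (fun _ => A).
Proof.
destruct model_nonempty as (x & Mx).
destruct (classic A) as [HA|HA].
- exists (FEq 0 0), (fun _ => x); split; [intro; auto|]; simpl; tauto.
- exists (FNot (FEq 0 0)), (fun _ => x); split; [intro; auto|]; simpl; tauto.
Qed.

Lemma definable_eq_var i j : definable (fun e => e i = e j).
Proof.
destruct model_nonempty as (x & Mx).
exists (FEq (2 * i) (2 * j)), (fun _ => x); split; [intro; auto|].
intros e He; unfold sat; rewrite !merge_var; tauto.
Qed.

Lemma definable_mem_var i j : definable (fun e => e i ∈ e j).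
Proof.
destruct model_nonempty as (x & Mx).
exists (FMem (2 * i) (2 * j)), (fun _ => x); split; [intro; auto|].
intros e He; unfold sat; rewrite !merge_var; tauto.
Qed.

Lemma definable_or P Q : definable P -> definable Q -> definable (fun e => P e \/ Q e).
Proof.
intros HP HQ; apply definable_ext with (fun e => ~ (~ P e /\ ~ Q e)).
- intros e _; tauto.
- apply definable_not, definable_and; now apply definable_not.
Qed.

Lemma definable_imp P Q : definable P -> definable Q -> definable (fun e => P e -> Q e).
Proof.
intros HP HQ; apply definable_ext with (fun e => ~ P e \/ Q e).
- intros e _; tauto.
- apply definable_or; [now apply definable_not|exact HQ].
Qed.

Lemma definable_iff P Q : definable P -> definable Q -> definable (fun e => P e <-> Q e).
Proof. intros HP HQ; apply definable_and; now apply definable_imp. Qed.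

Lemma definable_ex P : definable (fun e => P (e 0) (fun n => e (S n))) ->
  definable (fun e => exists x, M x /\ P x e).
Proof.
intros HP; apply definable_ext with (fun e => ~ forall x, M x -> ~ P x e).
- intros e _; split.
  + intros H; apply NNPP; intros H'; apply H; intros x Mx Px; eauto.
  + intros (x & Mx & Px) H; exact (H x Mx Px).
- now apply definable_not, (definable_all (fun x e => ~ P x e)), definable_not.
Qed.

Lemma term_var n : definable_term (fun e => e n).
Proof. split; [intros e He; apply He|apply (definable_eq_var 0 (S n))]. Qed.

Lemma term_const a : M a -> definable_term (fun _ => a).
Proof.
intros Ma; split; [auto|].
exists (FEq 0 1), (fun _ => a); split; [intro; auto|].
intros e He; simpl; tauto.
Qed.

(** Formulas have no function symbols, so substitution is rendered by quantifying over the single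
    value of [t e]. *)
Lemma definable_subst t P : definable_term t ->
  definable (fun e => P (e 0) (fun n => e (S n))) -> definable (fun e => P (t e) e).
Proof.
intros [Ht Dt] HP; apply definable_ext with (fun e => forall x, M x -> x = t e -> P x e).
- intros e He; split; [intros H; apply H; auto|intros H x _ ->; exact H].
- now apply (definable_all (fun x e => x = t e -> P x e)), definable_imp.
Qed.

Lemma definable_subst2 t s (P : U -> U -> Prop) : definable_term t -> definable_term s ->
  definable (fun e => P (e 0) (e 1)) -> definable (fun e => P (t e) (s e)).
Proof.
intros Ht Hs HP; apply (definable_subst t (fun x e => P x (s e)) Ht).
apply definable_ext with (fun e => forall y, M y -> y = s (fun n => e (S n)) -> P (e 0) y).
- intros e He; split; [intros H; apply H; auto|intros H x _ ->; exact H].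
  apply Hs; intros n; apply He.
- apply (definable_all (fun x e => x = s (fun n => e (S n)) -> P (e 0) x)), definable_imp.
  + exact (definable_rename (fun n => match n with 0 => 0 | S k => S (S k) end) _ (proj2 Hs)).
  + exact (definable_rename (fun n => match n with 0 => 1 | S k => 0 end) _ HP).
Qed.

Lemma definable_eq t s : definable_term t -> definable_term s ->
  definable (fun e => t e = s e).
Proof. intros Ht Hs; apply (definable_subst2 t s eq Ht Hs), definable_eq_var. Qed.

Lemma definable_mem t s : definable_term t -> definable_term s ->
  definable (fun e => t e ∈ s e).
Proof. intros Ht Hs; apply (definable_subst2 t s mem Ht Hs), definable_mem_var. Qed.

(** Members of a set of [M] are in [M] by transitivity, so a quantifier bounded by a set may run
    over [U] in Rocq and over [M] in the formula. This makes the Delta_0 notions of the statement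
    definable over [M]. *)
Lemma definable_allb t P : definable_term t ->
  definable (fun e => P (e 0) (fun n => e (S n))) ->
  definable (fun e => forall x, x ∈ t e -> P x e).
Proof.
intros Ht HP; apply definable_ext with (fun e => forall x, M x -> x ∈ t e -> P x e).
- intros e He; split; intros H x; [|auto].
  intros Hx; apply H; [|exact Hx]; apply M_trans with (t e); [apply Ht, He|exact Hx].
- apply (definable_all (fun x e => x ∈ t e -> P x e)), definable_imp; [|exact HP].
  apply definable_mem with (t := fun e => e 0); [apply term_var|].
  split; [intros e He; apply Ht; intros n; apply He|].
  exact (definable_rename (fun n => match n with 0 => 0 | S k => S (S k) end) _ (proj2 Ht)).
Qed.

Lemma definable_exb t P : definable_term t ->
  definable (fun e => P (e 0) (fun n => e (S n))) ->
  definable (fun e => exists x, x ∈ t e /\ P x e).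
Proof.
intros Ht HP; apply definable_ext with (fun e => ~ forall x, x ∈ t e -> ~ P x e).
- intros e _; split.
  + intros H; apply NNPP; intros H'; apply H; intros x Mx Px; eauto.
  + intros (x & Mx & Px) H; exact (H x Mx Px).
- now apply definable_not, (definable_allb t (fun x e => ~ P x e)), definable_not.
Qed.

Lemma term_app F t : definable_term (fun e => F (e 0)) -> definable_term t ->
  definable_term (fun e => F (t e)).
Proof.
intros [HF DF] Ht; split.
- intros e He; apply (HF (fun _ => t e)); intros n; apply Ht, He.
- apply (definable_subst2 (fun e => e 0) (fun e => t (fun n => e (S n))) (fun y x => y = F x)).
  + apply term_var.
  + split; [intros e He; apply Ht; intros n; apply He|].
    exact (definable_rename (fun n => match n with 0 => 0 | S k => S (S k) end) _ (proj2 Ht)).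
  + exact DF.
Qed.

(* Turns all variables but the first into parameters. *)
Lemma definable_fix P e : in_model e -> definable (fun e => P (e 0) (fun n => e (S n))) ->
  definable (fun e' => P (e' 0) e).
Proof.
intros He (p & r & Hr & E).
exists (rename (fun n => if Nat.even n then
   match Nat.div2 n with 0 => 0 | S k => S (2 * (2 * k)) end
   else S (2 * S (2 * Nat.div2 n))) p), (merge e r).
split; [now apply merge_in|]; intros e' He'.
rewrite sat_rename.
rewrite (E (scons (e' 0) e)) by (apply in_model_scons; auto).
match goal with |- sat _ ?a _ <-> sat _ ?b _ => replace b with a; [tauto|] end.
apply functional_extensionality; intros n; unfold merge at 1.
destruct (Nat.even n) eqn:Hn.
- destruct (Nat.div2 n) as [|k]; [reflexivity|].
  rewrite merge_par, merge_var; reflexivity.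
- rewrite merge_par, merge_par; reflexivity.
Qed.

Lemma term_shift t : definable_term t -> definable_term (fun e => t (fun n => e (S n))).
Proof.
intros Ht; split; [intros e He; apply Ht; intros n; apply He|].
exact (definable_rename (fun n => match n with 0 => 0 | S k => S (S k) end) _ (proj2 Ht)).
Qed.

(** Brings a binary predicate into the shape of the schemas in [ZFC], where [x] and [y] precede the
    parameters; all variables beyond the first read [y]. *)
Lemma definable_rel P : definable (fun e => P (e 0) (e 1)) ->
  exists p r, in_model r /\
    forall x y, M x -> M y -> (P x y <-> sat M (scons x (scons y r)) p).
Proof.
intros (p & r & Hr & E).
exists (rename (fun n => if Nat.even n then
   match Nat.div2 n with 0 => 0 | S _ => 1 end else S (S (Nat.div2 n))) p), r.
split; [exact Hr|]; intros x y Mx My; rewrite sat_rename.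
rewrite (E (fun n => match n with 0 => x | S _ => y end)) by (intros [|n]; auto).
match goal with |- sat _ ?a _ <-> sat _ ?b _ => replace b with a; [tauto|] end.
apply functional_extensionality; intros n; unfold merge.
destruct (Nat.even n); [|reflexivity]; destruct (Nat.div2 n); reflexivity.
Qed.

(** * Sets of the model *)

Lemma universe_inhabited : inhabited U.
Proof. destruct model_nonempty as (x & _); exact (inhabits x). Qed.

(* A junk value unless [P] has an extension in the universe. *)
Definition mk (P : U -> Prop) : U :=
  epsilon universe_inhabited (fun s => forall z, z ∈ s <-> P z).

Definition is_set (P : U -> Prop) : Prop := exists s, M s /\ forall z, z ∈ s <-> P z.

Lemma mk_eq P s : (forall z, z ∈ s <-> P z) -> mk P = s.
Proof.
intros H; apply mem_ext; intros z; rewrite H.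
apply (epsilon_spec universe_inhabited (fun s => forall z, z ∈ s <-> P z)); eauto.
Qed.

Lemma in_mk P z : is_set P -> (z ∈ mk P <-> P z).
Proof. intros (s & Ms & H); rewrite (mk_eq _ _ H); apply H. Qed.

Lemma M_mk P : is_set P -> M (mk P).
Proof. intros (s & Ms & H); rewrite (mk_eq _ _ H); exact Ms. Qed.

Lemma M_mem x y : M y -> x ∈ y -> M x.
Proof. apply M_trans. Qed.

Lemma term_mk (P : U -> (nat -> U) -> Prop) : (forall e, in_model e -> is_set (fun z => P z e)) ->
  definable (fun e => P (e 0) (fun n => e (S n))) ->
  definable_term (fun e => mk (fun z => P z e)).
Proof.
intros HS HP; split; [intros e He; now apply M_mk, HS|].
apply definable_ext with (fun e => forall z, M z -> (z ∈ e 0 <-> P z (fun n => e (S n)))).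
- intros e He; assert (He' : in_model (fun n => e (S n))) by (intros n; apply He).
  destruct (HS _ He') as (s & Ms & Hs); rewrite (mk_eq _ _ Hs); split.
  + intros H; apply mem_ext; intros z; split; intros Hz.
    * apply Hs, H; [|exact Hz]; apply M_mem with (e 0); auto.
    * apply H; [|now apply Hs]; now apply M_mem with s.
  + intros -> z _; apply Hs.
- apply (definable_all (fun z e => z ∈ e 0 <-> P z (fun n => e (S n)))).
  apply definable_iff; [apply definable_mem_var|].
  exact (definable_rename (fun n => match n with 0 => 0 | S k => S (S k) end) _ HP).
Qed.

Lemma is_set_sep a P : M a -> definable (fun e => P (e 0)) -> is_set (fun z => z ∈ a /\ P z).
Proof.
intros Ma HP; destruct (definable_rel (fun x _ => P x) HP) as (p & r & Hr & E).
destruct model_nonempty as (y & My).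
destruct (@zfc_separation U M M_zfc p (scons y r) (in_model_scons _ _ My Hr) a Ma) as (b & Mb & Hb).
exists b; split; [exact Mb|]; intros z; split.
- intros Hz; assert (Mz : M z) by now apply M_mem with b.
  apply (Hb z Mz) in Hz; rewrite <- E in Hz by auto; tauto.
- intros [Hz HPz]; assert (Mz : M z) by now apply M_mem with a.
  apply (Hb z Mz); rewrite <- E by auto; tauto.
Qed.

Lemma term_sep t P : definable_term t -> definable (fun e => P (e 0) (fun n => e (S n))) ->
  definable_term (fun e => mk (fun z => z ∈ t e /\ P z e)).
Proof.
intros Ht HP; apply term_mk.
- intros e He; apply is_set_sep; [now apply Ht|now apply definable_fix].
- apply definable_and; [|exact HP]; apply definable_mem; [apply term_var|now apply term_shift].
Qed.

Lemma is_set_repl a P : M a -> definable (fun e => P (e 0) (e 1)) ->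
  (forall x y y', x ∈ a -> M y -> M y' -> P x y -> P x y' -> y = y') ->
  is_set (fun y => M y /\ exists x, x ∈ a /\ P x y).
Proof.
intros Ma HP HF; destruct (definable_rel P HP) as (p & r & Hr & E).
destruct (@zfc_replacement U M M_zfc p r Hr a Ma) as (b & Mb & Hb).
- intros x y y' Mx My My' Hx; rewrite <- !E by auto; eauto.
- exists b; split; [exact Mb|]; intros y; split.
  + intros Hy; assert (My : M y) by now apply M_mem with b.
    apply (Hb y My) in Hy; destruct Hy as (x & Mx & Hx & S).
    rewrite <- E in S by auto; eauto.
  + intros (My & x & Hx & S); apply (Hb y My).
    assert (Mx : M x) by now apply M_mem with a.
    exists x; rewrite <- E by auto; auto.
Qed.

Lemma is_set_image a F : M a -> definable_term (fun e => F (e 0)) ->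
  is_set (fun y => exists x, x ∈ a /\ y = F x).
Proof.
intros Ma HF; destruct (is_set_repl a (fun x y => y = F x) Ma) as (s & Ms & Hs).
- apply definable_eq; [apply term_var|exact HF].
- congruence.
- exists s; split; [exact Ms|]; intros z; rewrite Hs; split; [tauto|].
  intros (x & Hx & ->); split; [|eauto].
  apply (proj1 HF (fun _ => x)); intros n; now apply M_mem with a.
Qed.

Lemma is_set_upair x y : M x -> M y -> is_set (fun z => z = x \/ z = y).
Proof.
intros Mx My; destruct (@zfc_pairing U M M_zfc x y Mx My) as (p & Mp & Hp).
exists p; split; [exact Mp|]; intros z; split; intros Hz.
- apply Hp; [now apply M_mem with p|exact Hz].
- apply Hp; [destruct Hz; subst; auto|exact Hz].
Qed.

Lemma is_set_union x : M x -> is_set (fun z => exists y, y ∈ x /\ z ∈ y).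
Proof.
intros Mx; destruct (@zfc_union U M M_zfc x Mx) as (u & Mu & Hu).
exists u; split; [exact Mu|]; intros z; split; intros Hz.
- apply Hu in Hz; [|now apply M_mem with u]; destruct Hz as (y & _ & ?); eauto.
- destruct Hz as (y & Hy & Hz).
  assert (My : M y) by now apply M_mem with x.
  apply Hu; [now apply M_mem with y|eauto].
Qed.

Lemma is_set_power x : M x -> is_set (fun z => M z /\ z ⊆ x).
Proof.
intros Mx; destruct (@zfc_powerset U M M_zfc x Mx) as (p & Mp & Hp).
assert (E : forall z, M z -> (z ∈ p <-> z ⊆ x)).
{ intros z Mz; rewrite Hp by exact Mz; split; intros H w; [|auto].
  intros Hw; apply H; [now apply M_mem with z|exact Hw]. }
exists p; split; [exact Mp|]; intros z; split.
- intros Hz; assert (Mz : M z) by now apply M_mem with p.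
  split; [exact Mz|now apply E].
- intros [Mz Hz]; now apply E.
Qed.

Definition upair x y : U := mk (fun z => z = x \/ z = y).
Definition pr x y : U := upair (upair x x) (upair x y).
Definition Union (x : U) : U := mk (fun z => exists y, y ∈ x /\ z ∈ y).
Definition cup x y : U := Union (upair x y).
Definition succ x : U := cup x (upair x x).
Definition Pow (x : U) : U := mk (fun z => M z /\ z ⊆ x).
Definition sep (a : U) (P : U -> Prop) : U := mk (fun z => z ∈ a /\ P z).
Definition image (F : U -> U) (a : U) : U := mk (fun y => exists x, x ∈ a /\ y = F x).
Definition emptyset : U := mk (fun _ => False).

Lemma term_upair t s : definable_term t -> definable_term s ->
  definable_term (fun e => upair (t e) (s e)).
Proof.
intros Ht Hs; apply term_mk.
- intros e He; apply is_set_upair; [now apply Ht|now apply Hs].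
- apply definable_or; (apply definable_eq; [apply term_var|]); now apply term_shift.
Qed.

Lemma term_pr t s : definable_term t -> definable_term s ->
  definable_term (fun e => pr (t e) (s e)).
Proof. intros; unfold pr; repeat apply term_upair; assumption. Qed.

Lemma term_Union t : definable_term t -> definable_term (fun e => Union (t e)).
Proof.
intros Ht; apply term_mk.
- intros e He; now apply is_set_union, Ht.
- apply (definable_exb (fun e => t (fun n => e (S n))) (fun x e => e 0 ∈ x)).
  + now apply term_shift.
  + apply definable_mem_var.
Qed.

Lemma term_cup t s : definable_term t -> definable_term s ->
  definable_term (fun e => cup (t e) (s e)).
Proof. intros; unfold cup; now apply term_Union, term_upair. Qed.

Lemma term_succ t : definable_term t -> definable_term (fun e => succ (t e)).
Proof. intros; unfold succ; now apply term_cup, term_upair. Qed.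

Lemma term_Pow t : definable_term t -> definable_term (fun e => Pow (t e)).
Proof.
intros Ht; apply term_mk.
- intros e He; now apply is_set_power, Ht.
- apply definable_and.
  + apply definable_ext with (fun _ => True); [|apply definable_prop].
    intros e He; split; auto.
  + apply (definable_allb (fun e => e 0) (fun x e => x ∈ t (fun n => e (S n))) (term_var 0)).
    apply definable_mem; [apply term_var|exact (term_shift _ (term_shift _ Ht))].
Qed.

Lemma term_image t F : definable_term t -> definable_term (fun e => F (e 0)) ->
  definable_term (fun e => image F (t e)).
Proof.
intros Ht HF; apply term_mk.
- intros e He; apply is_set_image; [now apply Ht|exact HF].
- apply (definable_exb (fun e => t (fun n => e (S n))) (fun x e => e 0 = F x)).
  + now apply term_shift.
  + apply definable_eq; [apply term_var|exact HF].
Qed.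

Lemma M_of_term F x : definable_term (fun e => F (e 0)) -> M x -> M (F x).
Proof. intros HF Mx; apply (proj1 HF (fun _ => x)); intro; exact Mx. Qed.

Lemma is_set_empty : is_set (fun _ => False).
Proof.
destruct model_nonempty as (x & Mx).
destruct (is_set_sep x (fun _ => False) Mx (definable_prop False)) as (s & Ms & Hs).
exists s; split; [exact Ms|]; intros z; rewrite Hs; tauto.
Qed.

Lemma M_upair x y : M x -> M y -> M (upair x y).
Proof. intros; apply M_mk, is_set_upair; assumption. Qed.
Lemma M_pr x y : M x -> M y -> M (pr x y).
Proof. intros; apply M_upair; apply M_upair; assumption. Qed.
Lemma M_Union x : M x -> M (Union x).
Proof. intros; apply M_mk, is_set_union; assumption. Qed.
Lemma M_cup x y : M x -> M y -> M (cup x y).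
Proof. intros; apply M_Union, M_upair; assumption. Qed.
Lemma M_succ x : M x -> M (succ x).
Proof. intros; apply M_cup; [|apply M_upair]; assumption. Qed.
Lemma M_Pow x : M x -> M (Pow x).
Proof. intros; apply M_mk, is_set_power; assumption. Qed.
Lemma M_sep a P : M a -> definable (fun e => P (e 0)) -> M (sep a P).
Proof. intros; apply M_mk, is_set_sep; assumption. Qed.
Lemma M_image F a : M a -> definable_term (fun e => F (e 0)) -> M (image F a).
Proof. intros; apply M_mk, is_set_image; assumption. Qed.
Lemma M_empty : M emptyset.
Proof. apply M_mk, is_set_empty. Qed.

Lemma in_upair x y z : M x -> M y -> (z ∈ upair x y <-> z = x \/ z = y).
Proof. intros; apply in_mk, is_set_upair; assumption. Qed.
Lemma in_Union x z : M x -> (z ∈ Union x <-> exists y, y ∈ x /\ z ∈ y).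
Proof. intros; apply (in_mk (fun z => exists y, y ∈ x /\ z ∈ y)), is_set_union; assumption. Qed.
Lemma in_cup x y z : M x -> M y -> (z ∈ cup x y <-> z ∈ x \/ z ∈ y).
Proof.
intros; unfold cup; rewrite in_Union by now apply M_upair.
split.
- intros (w & Hw & Hz); apply in_upair in Hw; try assumption.
  destruct Hw as [-> | ->]; auto.
- intros [Hz|Hz]; [exists x|exists y]; rewrite in_upair by assumption; auto.
Qed.
Lemma in_succ x z : M x -> (z ∈ succ x <-> z ∈ x \/ z = x).
Proof.
intros; unfold succ; rewrite in_cup, in_upair; try assumption; [tauto|].
now apply M_upair.
Qed.
Lemma in_Pow x z : M x -> (z ∈ Pow x <-> M z /\ z ⊆ x).
Proof. intros; apply (in_mk (fun z => M z /\ z ⊆ x)), is_set_power; assumption. Qed.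
Lemma in_sep a P z : M a -> definable (fun e => P (e 0)) -> (z ∈ sep a P <-> z ∈ a /\ P z).
Proof. intros; apply (in_mk (fun z => z ∈ a /\ P z)), is_set_sep; assumption. Qed.
Lemma in_image F a y : M a -> definable_term (fun e => F (e 0)) ->
  (y ∈ image F a <-> exists x, x ∈ a /\ y = F x).
Proof. intros; apply (in_mk (fun y => exists x, x ∈ a /\ y = F x)), is_set_image; assumption. Qed.
Lemma in_empty z : ~ z ∈ emptyset.
Proof. intros H; apply (in_mk (fun _ => False)) in H; [exact H|apply is_set_empty]. Qed.

Lemma is_upair_eq p x y : M x -> M y -> (is_upair p x y <-> p = upair x y).
Proof.
intros Mx My; split.
- intros H; apply mem_ext; intros z; rewrite in_upair by assumption; apply H.
- intros -> z; now apply in_upair.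
Qed.

(** The sets [u] and [v] of [is_pair] range over all of [U], but extensionality forces them to be
    [upair x x] and [upair x y], which lie in [M]. *)
Lemma is_pair_eq p x y : M x -> M y -> (is_pair p x y <-> p = pr x y).
Proof.
intros Mx My; split.
- intros (u & v & Hu & Hv & Hp); apply is_upair_eq in Hu, Hv; try assumption; subst u v.
  now apply is_upair_eq in Hp; [|apply M_upair..].
- intros ->; exists (upair x x), (upair x y).
  rewrite !is_upair_eq by (try assumption; now apply M_upair); auto.
Qed.

Lemma upair_inj1 x y z : M x -> M y -> M z -> upair x x = upair y z -> x = y /\ x = z.
Proof.
intros Mx My Mz E.
assert (H : forall w, w ∈ upair x x <-> w ∈ upair y z) by (rewrite E; tauto).
split; [specialize (H y)|specialize (H z)]; rewrite !in_upair in H by assumption; intuition.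
Qed.

Lemma pr_inj x y x' y' : M x -> M y -> M x' -> M y' -> pr x y = pr x' y' -> x = x' /\ y = y'.
Proof.
intros Mx My Mx' My' E; unfold pr in E.
assert (Hm : forall a b, M a -> M b -> M (upair a b)) by (intros; now apply M_upair).
assert (H : forall w, w ∈ upair (upair x x) (upair x y) <-> w ∈ upair (upair x' x') (upair x' y'))
  by (rewrite E; tauto).
assert (Ex : x = x').
{ destruct (H (upair x x)) as [H1 _]; rewrite !in_upair in H1 by auto.
  destruct (H1 (or_introl eq_refl)) as [H2|H2]; apply upair_inj1 in H2; tauto. }
subst x'; split; [reflexivity|].
destruct (H (upair x y)) as [H1 _]; destruct (H (upair x y')) as [_ H2].
rewrite !in_upair in H1, H2 by auto.
assert (G : forall a, M a -> upair x a = upair x x -> a = x).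
{ intros a Ma Ea; symmetry in Ea; apply upair_inj1 in Ea; intuition. }
destruct (H1 (or_intror eq_refl)) as [H3|H3].
- apply G in H3; [|assumption]; subst y.
  destruct (H2 (or_intror eq_refl)) as [H4|H4]; apply G in H4; auto.
- destruct (H2 (or_intror eq_refl)) as [H4|H4].
  + apply G in H4; [|assumption]; subst y'. now apply G in H3.
  + assert (I : y ∈ upair x y') by (rewrite <- H3; apply in_upair; auto).
    assert (I' : y' ∈ upair x y) by (rewrite H3; apply in_upair; auto).
    rewrite in_upair in I, I' by assumption.
    intuition congruence.
Qed.

Lemma app_eq f x y : M f -> M x -> M y -> (app f x y <-> pr x y ∈ f).
Proof.
intros Mf Mx My; split.
- intros (p & Hp & H); apply is_pair_eq in H; congruence.
- intros H; exists (pr x y); split; [exact H|now apply is_pair_eq].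
Qed.

Lemma app_M f x y : M f -> app f x y -> M x /\ M y.
Proof.
intros Mf (p & Hp & u & v & Hu & Hv & H).
assert (Mp : M p) by now apply M_mem with f.
assert (Mv : M v) by (apply M_mem with p; [exact Mp|apply H; auto]).
split; apply M_mem with v; auto; apply Hv; auto.
Qed.

Lemma definable_subst1 t (P : U -> Prop) : definable_term t ->
  definable (fun e => P (e 0)) -> definable (fun e => P (t e)).
Proof. intros Ht HP; apply (definable_subst t (fun x _ => P x) Ht HP). Qed.

(* The union of the y with P y makes this the empty set, hence still definable,
   when there is no such y. *)
Definition the (P : U -> Prop) : U := mk (fun z => exists y, M y /\ P y /\ z ∈ y).

(* The union of all values of f at x, so that it is defined for all sets f and x. *)
Definition ap (f x : U) : U := Union (the (fun s => forall y, M y -> (y ∈ s <-> pr x y ∈ f))).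

Ltac solve_M :=
  match goal with
  | |- in_model _ -> M _ => intro; solve_M
  | |- M ?x =>
    first
      [ assumption
      | apply M_pr; solve_M
      | apply M_Union; solve_M
      | apply M_upair; solve_M
      | apply M_cup; solve_M
      | apply M_succ; solve_M
      | apply M_Pow; solve_M
      | apply M_empty
      | match goal with H : x ∈ ?y |- _ => apply (M_mem x y); [solve [solve_M] | exact H] end
      | match goal with H : definable_term (fun e => ?F (e 0)) |- M (?F ?a) =>
          apply (M_of_term F a H); solve_M end
      | match goal with H : in_model ?e |- M (?e _) => apply H end ]
  end.

Lemma is_set_ext P Q : (forall z, P z <-> Q z) -> is_set P -> is_set Q.
Proof. intros H (s & Ms & Hs); exists s; split; [exact Ms|]; intros z; now rewrite Hs. Qed.

Lemma the_eq P y : M y -> P y -> (forall y', M y' -> P y' -> y' = y) -> the P = y.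
Proof.
intros My Py Uy; apply mk_eq; intros z; split; [eauto|].
intros (y' & My' & Py' & Hz); now rewrite <- (Uy y').
Qed.

(** Uniqueness keeps the union a set: it is the witness itself or, if there is none, empty. *)
Lemma term_the (P : U -> (nat -> U) -> Prop) :
  (forall e y y', in_model e -> M y -> M y' -> P y e -> P y' e -> y = y') ->
  definable (fun e => P (e 0) (fun n => e (S n))) ->
  definable_term (fun e => the (fun y => P y e)).
Proof.
intros HU HP; apply term_mk.
- intros e He; destruct (classic (exists y, M y /\ P y e)) as [(y & My & Py)|N].
  + exists y; split; [exact My|]; intros z; split; [eauto|].
    intros (y' & My' & Py' & Hz); now rewrite (HU e y y').
  + exists emptyset; split; [apply M_empty|]; intros z; split.
    * intros H; destruct (in_empty _ H).
    * intros (y' & My' & Py' & Hz); destruct N; eauto.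
- apply (definable_ex (fun y e => P y (fun n => e (S n)) /\ e 0 ∈ y)).
  apply definable_and; [|apply definable_mem_var].
  exact (definable_rename (fun n => match n with 0 => 0 | S k => S (S k) end) _ HP).
Qed.

(** Directed by the syntax of the goal; [tac] is a hook through which later layers add rules for new
    notions. *)
Ltac dfn_step tac :=
  cbv beta;
  match goal with
  | |- definable_term (fun e => e _) => apply term_var
  | |- definable_term (fun e => pr _ _) => apply term_pr
  | |- definable_term (fun e => Union _) => apply term_Union
  | |- definable_term (fun e => upair _ _) => apply term_upair
  | |- definable_term (fun e => cup _ _) => apply term_cup
  | |- definable_term (fun e => succ _) => apply term_succ
  | |- definable_term (fun e => Pow _) => apply term_Pow
  | |- definable_term (fun e => image ?F _) => apply term_image
  | H : definable_term (fun e => ?F (e 0)) |- definable_term (fun e => ?F _) => apply (term_app F _ H)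
  | |- definable_term _ => apply term_const; solve [solve_M]
  | |- definable_term _ => assumption
  | |- definable (fun _ => ?A) => apply (definable_prop A)
  | |- definable (fun e => (_ = _)) => apply definable_eq
  | |- definable (fun e => (_ ∈ _)) => apply definable_mem
  | |- definable (fun e => ~ _) => apply definable_not
  | |- definable (fun e => (_ <-> _)) => apply definable_iff
  | |- definable (fun e => (_ /\ _)) => apply definable_and
  | |- definable (fun e => (_ \/ _)) => apply definable_or
  | |- definable (fun e => exists x, M x /\ _) => apply definable_ex
  | |- definable (fun e => exists x, x ∈ _ /\ _) => apply definable_exb
  | |- definable (fun e => forall x, M x -> _) => apply definable_all
  | |- definable (fun e => forall x, x ∈ _ -> _) => apply definable_allb
  | H : definable (fun e => ?P (e 0) (e 1)) |- definable (fun e => ?P _ _) =>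
      apply (definable_subst2 _ _ P); [| |exact H]
  | H : definable (fun e => ?P (e 0)) |- definable (fun e => ?P _) =>
      apply (definable_subst1 _ P); [|exact H]
  | |- definable _ => assumption
  | |- _ => tac tt
  | |- definable (fun e => _ -> _) => apply definable_imp
  end.

Ltac no_rule u := fail.
Ltac dfn0 := repeat dfn_step no_rule.

Lemma definable_subset : definable (fun e => e 0 ⊆ e 1).
Proof. unfold subset; dfn0. Qed.

Lemma definable_transitive_set : definable (fun e => transitive_set (e 0)).
Proof. unfold transitive_set, subset; dfn0. Qed.

Lemma definable_ordinal : definable (fun e => ordinal (e 0)).
Proof.
apply definable_ext with (fun e => transitive_set (e 0) /\
  forall y, y ∈ e 0 -> forall z, z ∈ e 0 -> y ∈ z \/ y = z \/ z ∈ y).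
- intros e _; split; intros [H1 H2]; split; auto.
- pose proof definable_transitive_set as H; dfn0.
Qed.

Lemma definable_limit_ordinal : definable (fun e => limit_ordinal (e 0)).
Proof.
apply definable_ext with (fun e => ordinal (e 0) /\ (exists y, y ∈ e 0 /\ True) /\
   forall y, y ∈ e 0 -> exists z, z ∈ e 0 /\ y ∈ z).
- intros e _; split; [intros (H1 & (y & Hy & _) & H2)|intros (H1 & (y & Hy) & H2)];
  (split; [exact H1|split; [eauto|exact H2]]).
- pose proof definable_ordinal as H; dfn0.
Qed.

(** The conjunctions are regrouped so that each existential quantifier shows its bounding set first,
    the shape that the rules for bounded quantifiers recognize. *)
Lemma definable_club : definable (fun e => club (e 0) (e 1)).
Proof.
apply definable_ext with (fun e => (forall z, z ∈ e 1 -> z ∈ e 0) /\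
   (forall x, x ∈ e 0 -> exists y, y ∈ e 1 /\ ~ y ∈ x) /\
   forall d, d ∈ e 0 -> limit_ordinal d ->
     (forall x, x ∈ d -> exists y, y ∈ e 1 /\ (y ∈ d /\ ~ y ∈ x)) -> d ∈ e 1).
- assert (A : forall P Q R : U -> Prop, (exists y, P y /\ Q y /\ R y) <->
    exists y, (P y /\ Q y) /\ R y) by (intros P Q R; split; intros (y & Hy); exists y; tauto).
  intros e _; unfold club, closed, unbounded, subset.
  split; intros (H1 & H2 & H3); (split; [exact H1|split; [exact H2|]]);
    intros d Hd Ld H; apply (H3 d Hd Ld); intros x Hx; apply A, (H x Hx).
- pose proof definable_limit_ordinal as H; dfn0.
Qed.

Ltac basic_rule u :=
  match goal with
  | |- definable (fun e => (_ ⊆ _)) => apply (definable_subst2 _ _ subset); [| |exact definable_subset]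
  | |- definable (fun e => ordinal _) => apply (definable_subst1 _ ordinal); [|exact definable_ordinal]
  | |- definable (fun e => limit_ordinal _) =>
      apply (definable_subst1 _ limit_ordinal); [|exact definable_limit_ordinal]
  | |- definable (fun e => club _ _) => apply (definable_subst2 _ _ club); [| |exact definable_club]
  end.
Ltac dfn1 := repeat dfn_step basic_rule.

(** * Ordinals *)

Lemma mem_irrefl (x : U) : ~ x ∈ x.
Proof.
induction (mem_wf x) as [x _ IH]; intros H; exact (IH x H H).
Qed.

Lemma mem_asym (x y : U) : x ∈ y -> ~ y ∈ x.
Proof.
revert y; induction (mem_wf x) as [x _ IH]; intros y Hxy Hyx; exact (IH y Hyx x Hyx Hxy).
Qed.

Lemma mem_no_3cycle (x y z : U) : x ∈ y -> y ∈ z -> ~ z ∈ x.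
Proof.
revert y z; induction (mem_wf x) as [x _ IH]; intros y z H1 H2 H3.
exact (IH z H3 x y H3 H1 H2).
Qed.

Lemma least (P : U -> Prop) x : P x -> exists y, P y /\ forall z, z ∈ y -> ~ P z.
Proof.
induction (mem_wf x) as [x _ IH]; intros Px.
destruct (classic (exists z, z ∈ x /\ P z)) as [(z & Hz & Pz)|N]; [eauto|].
exists x; split; [exact Px|]; intros z Hz Pz; eauto.
Qed.

Lemma ordinal_mem (a b : U) : ordinal a -> b ∈ a -> ordinal b.
Proof.
intros [T C] Hb; split.
- intros y Hy z Hz.
  destruct (C z b) as [H|[H|H]]; auto.
  + apply (T y); [apply (T b)|]; assumption.
  + subst z; exfalso; exact (mem_asym _ _ Hy Hz).
  + exfalso.
    exact (mem_no_3cycle z y b Hz Hy H).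
- intros y z Hy Hz; apply C; apply (T b); assumption.
Qed.

Lemma ordinal_trans (a b c : U) : ordinal a -> b ∈ a -> c ∈ b -> c ∈ a.
Proof. intros [T _] Hb Hc; exact (T b Hb c Hc). Qed.

Lemma ordinal_trichotomy (a b : U) : ordinal a -> ordinal b -> a ∈ b \/ a = b \/ b ∈ a.
Proof.
revert b; induction (mem_wf a) as [a _ IHa]; intros b Oa.
induction (mem_wf b) as [b _ IHb]; intros Ob.
destruct (classic (a ∈ b)) as [H1|H1]; [tauto|].
destruct (classic (b ∈ a)) as [H2|H2]; [tauto|].
right; left; apply mem_ext; intros z; split; intros Hz.
- destruct (IHa z Hz b) as [H|[H|H]]; auto.
  + now apply ordinal_mem with a.
  + subst z; tauto.
  + destruct H2; now apply ordinal_trans with z.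
- destruct (IHb z Hz) as [H|[H|H]]; auto.
  + now apply ordinal_mem with b.
  + destruct H1; now apply ordinal_trans with z.
  + subst z; tauto.
Qed.

Lemma ordinal_nmem (a b : U) : ordinal a -> ordinal b -> ~ a ∈ b -> b ∈ a \/ b = a.
Proof. intros Oa Ob; destruct (ordinal_trichotomy a b Oa Ob) as [H|[H|H]]; auto; tauto. Qed.

Lemma ordinal_nmem_subset (a b : U) : ordinal a -> ordinal b -> ~ a ∈ b -> b ⊆ a.
Proof.
intros Oa Ob H; destruct (ordinal_nmem a b Oa Ob H) as [Hb| ->]; intros z Hz; [|exact Hz].
now apply ordinal_trans with b.
Qed.

Lemma ordinal_subset_nmem (a b : U) : b ⊆ a -> ~ a ∈ b.
Proof. intros H Ha; exact (mem_irrefl _ (H _ Ha)). Qed.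

Lemma ordinal_succ a : M a -> ordinal a -> ordinal (succ a).
Proof.
intros Ma Oa; split.
- intros y Hy z Hz; rewrite in_succ in * by exact Ma.
  left; destruct Hy as [Hy| ->]; [|exact Hz]; now apply ordinal_trans with y.
- intros y z Hy Hz; rewrite in_succ in * by exact Ma.
  apply ordinal_trichotomy.
  + destruct Hy as [Hy| ->]; [now apply ordinal_mem with a|exact Oa].
  + destruct Hz as [Hz| ->]; [now apply ordinal_mem with a|exact Oa].
Qed.

Lemma ordinal_of_ordinals (s : U) : transitive_set s -> (forall x, x ∈ s -> ordinal x) -> ordinal s.
Proof. intros T H; split; [exact T|]; intros y z Hy Hz; apply ordinal_trichotomy; auto. Qed.

Lemma ordinal_Union s : M s -> (forall x, x ∈ s -> ordinal x) -> ordinal (Union s).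
Proof.
intros Ms H; apply ordinal_of_ordinals.
- intros y Hy z Hz; apply in_Union in Hy; [|exact Ms]; destruct Hy as (x & Hx & Hy).
  apply in_Union; [exact Ms|]; exists x; split; [exact Hx|].
  apply ordinal_trans with y; auto.
- intros y Hy; apply in_Union in Hy; [|exact Ms]; destruct Hy as (x & Hx & Hy).
  apply ordinal_mem with x; auto.
Qed.

(** The union acts as predecessor function: [iteration] reads the previous value through it, and
    injectivity of [succ] follows. *)
Lemma Union_succ a : M a -> ordinal a -> Union (succ a) = a.
Proof.
intros Ma Oa; apply mem_ext; intros z; rewrite in_Union by now apply M_succ.
split.
- intros (y & Hy & Hz); apply in_succ in Hy; [|exact Ma].
  destruct Hy as [Hy| ->]; [now apply ordinal_trans with y|exact Hz].
- intros Hz; exists a; split; [apply in_succ; auto|exact Hz].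
Qed.

Lemma limit_succ k x : limit_ordinal k -> M k -> x ∈ k -> succ x ∈ k.
Proof.
intros (Ok & _ & L) Mk Hx; assert (Mx : M x) by solve_M.
destruct (L x Hx) as (z & Hz & Hxz).
destruct (ordinal_trichotomy (succ x) k) as [H|[H|H]]; auto.
- apply ordinal_succ; [|apply ordinal_mem with k]; auto.
- exfalso; subst k; apply in_succ in Hz; [|exact Mx].
  destruct Hz as [Hz| ->]; [exact (mem_asym _ _ Hz Hxz)|exact (mem_irrefl _ Hxz)].
- exfalso; apply in_succ in H; [|exact Mx].
  destruct H as [H| ->]; [exact (mem_asym _ _ H Hx)|exact (mem_irrefl _ Hx)].
Qed.

Lemma ordinal_max (a x y : U) : ordinal a -> x ∈ a -> y ∈ a ->
  exists z, z ∈ a /\ x ⊆ z /\ y ⊆ z.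
Proof.
intros Oa Hx Hy; assert (Ox : ordinal x) by now apply ordinal_mem with a.
assert (Oy : ordinal y) by now apply ordinal_mem with a.
destruct (classic (x ∈ y)) as [H|H].
- exists y; repeat split; auto; intros z Hz; [now apply ordinal_trans with x|exact Hz].
- exists x; repeat split; auto; [intros z Hz; exact Hz|]; now apply ordinal_nmem_subset.
Qed.

(** * Functions *)

Definition term_fun (F : U -> U) : Prop := definable_term (fun e => F (e 0)).

Lemma M_fun F x : term_fun F -> M x -> M (F x).
Proof. apply M_of_term. Qed.

Definition lam (a : U) (F : U -> U) : U := image (fun x => pr x (F x)) a.

Definition dom (f : U) : U := sep (Union (Union f)) (fun x => exists y, M y /\ pr x y ∈ f).
Definition ran (f : U) : U := sep (Union (Union f)) (fun y => exists x, M x /\ pr x y ∈ f).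

(** By Kuratowski's coding [upair x y] is a member of [pr x y], so two unions reach the components.
    This gives [dom] and [ran] a set to be separated from. *)
Lemma pr_in_Union f x y : M f -> M x -> M y -> pr x y ∈ f ->
  x ∈ Union (Union f) /\ y ∈ Union (Union f).
Proof.
intros Mf Mx My H.
assert (Hu : upair x y ∈ Union f).
{ apply in_Union; [exact Mf|]; exists (pr x y); split; [exact H|].
  apply in_upair; auto; solve_M. }
split; (apply in_Union; [solve_M|]; exists (upair x y); split; [exact Hu|];
  apply in_upair; auto).
Qed.

Lemma in_dom f x : M f -> M x -> (x ∈ dom f <-> exists y, M y /\ pr x y ∈ f).
Proof.
intros Mf Mx; unfold dom; rewrite in_sep; [|solve_M|dfn1].
split; [tauto|]; intros (y & My & H); split; [|eauto].
apply (pr_in_Union f x y); assumption.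
Qed.

Lemma in_ran f y : M f -> M y -> (y ∈ ran f <-> exists x, M x /\ pr x y ∈ f).
Proof.
intros Mf My; unfold ran; rewrite in_sep; [|solve_M|dfn1].
split; [tauto|]; intros (x & Mx & H); split; [|eauto].
apply (pr_in_Union f x y); assumption.
Qed.

Lemma term_dom : term_fun dom.
Proof. apply term_sep; dfn1. Qed.

Lemma term_ran : term_fun ran.
Proof. apply term_sep; dfn1. Qed.

Lemma term_ap2 t s : definable_term t -> definable_term s ->
  definable_term (fun e => ap (t e) (s e)).
Proof.
intros Ht Hs; unfold ap; apply term_Union.
apply term_the.
- intros e y y' He My My' H H'; apply mem_ext; intros z; split; intros Hz.
  + assert (Mz : M z) by solve_M; now apply H', H.
  + assert (Mz : M z) by solve_M; now apply H, H'.
- dfn1; [apply (term_shift _ (term_shift _ Hs))|apply (term_shift _ (term_shift _ Ht))].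
Qed.

Lemma ap_eq f x y : M f -> M x -> M y -> pr x y ∈ f ->
  (forall y', M y' -> pr x y' ∈ f -> y' = y) -> ap f x = y.
Proof.
intros Mf Mx My H HU; unfold ap.
assert (E : the (fun s => forall y, M y -> (y ∈ s <-> pr x y ∈ f)) = upair y y).
{ apply the_eq; [solve_M| |].
  - intros z Mz; rewrite in_upair by assumption; split; [|eauto].
    intros [-> | ->]; exact H.
  - intros s Ms Hs; apply mem_ext; intros z; rewrite in_upair by assumption; split.
    + intros Hz; assert (Mz : M z) by solve_M; left; now apply HU, Hs.
    + intros [-> | ->]; now apply Hs. }
rewrite E; apply mem_ext; intros z; rewrite in_Union by solve_M; split.
- intros (w & Hw & Hz); apply in_upair in Hw; try assumption; destruct Hw; subst; exact Hz.
- intros Hz; exists y; split; [apply in_upair; auto|exact Hz].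
Qed.

Lemma term_lam F t : term_fun F -> definable_term t -> definable_term (fun e => lam (t e) F).
Proof. intros HF Ht; unfold lam, term_fun in *; apply term_image; [exact Ht|dfn1]. Qed.

Lemma M_lam a F : M a -> term_fun F -> M (lam a F).
Proof. intros Ma HF; unfold lam, term_fun in *; apply M_image; [exact Ma|dfn1]. Qed.

Lemma in_lam a F p : M a -> term_fun F -> (p ∈ lam a F <-> exists x, x ∈ a /\ p = pr x (F x)).
Proof. intros Ma HF; unfold lam, term_fun in *; apply in_image; [exact Ma|dfn1]. Qed.

Lemma pr_in_lam a F x y : M a -> term_fun F -> M x -> M y ->
  (pr x y ∈ lam a F <-> x ∈ a /\ y = F x).
Proof.
intros Ma HF Mx My; rewrite in_lam by assumption; split.
- intros (x' & Hx & E); unfold term_fun in HF.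
  apply pr_inj in E; try solve_M; destruct E; subst; auto.
- intros [Hx ->]; eauto.
Qed.

Lemma app_lam a F x y : M a -> term_fun F -> (app (lam a F) x y <-> x ∈ a /\ y = F x).
Proof.
intros Ma HF; assert (Ml : M (lam a F)) by now apply M_lam.
split.
- intros H; destruct (app_M _ _ _ Ml H) as [Mx My].
  rewrite app_eq in H by assumption; now apply pr_in_lam in H.
- intros [Hx ->]; assert (Mx : M x) by solve_M; unfold term_fun in HF.
  rewrite app_eq by solve_M || assumption; apply pr_in_lam; auto; solve_M.
Qed.

Lemma map_lam a b F : M a -> term_fun F -> (forall x, x ∈ a -> F x ∈ b) -> map (lam a F) a b.
Proof.
intros Ma HF H; split; [split|].
- intros p Hp; apply in_lam in Hp; auto; destruct Hp as (x & Hx & ->).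
  exists x, (F x); split; [exact Hx|]; unfold term_fun in HF; apply is_pair_eq; solve_M || auto.
- intros x Hx; exists (F x); split; [now apply app_lam|].
  intros y Hy; apply app_lam in Hy; intuition.
- intros x y Hy; apply app_lam in Hy; auto; destruct Hy as [Hx ->]; auto.
Qed.

Lemma ap_lam a F x : M a -> term_fun F -> x ∈ a -> ap (lam a F) x = F x.
Proof.
intros Ma HF Hx; assert (Mx : M x) by solve_M.
assert (MFx : M (F x)) by now apply M_fun.
apply ap_eq; auto; [now apply M_lam|now apply pr_in_lam|].
intros y My H; now apply pr_in_lam in H.
Qed.

Lemma function_ap f a x : M f -> function_on f a -> x ∈ a -> app f x (ap f x).
Proof.
intros Mf [_ H] Hx; destruct (H x Hx) as (y & Hy & Uy).
destruct (app_M _ _ _ Mf Hy) as [Mx My].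
replace (ap f x) with y; [exact Hy|symmetry].
apply ap_eq; auto; [now apply app_eq|].
intros y' My' H'; symmetry; apply Uy; now apply app_eq.
Qed.

Lemma function_app f a x y : M f -> function_on f a -> app f x y -> x ∈ a /\ y = ap f x.
Proof.
intros Mf Hf H; destruct (app_M _ _ _ Mf H) as [Mx My].
assert (Hx : x ∈ a).
{ destruct H as (p & Hp & Hxy); destruct (proj1 Hf p Hp) as (x' & y' & Hx' & Hp').
  assert (Happ : app f x' y') by (exists p; auto).
  destruct (app_M _ _ _ Mf Happ) as [Mx' My'].
  apply is_pair_eq in Hxy, Hp'; auto; subst p; apply pr_inj in Hp'; auto.
  destruct Hp'; subst; exact Hx'. }
split; [exact Hx|].
destruct (proj2 Hf x Hx) as (z & Hz & Uz).
rewrite <- (Uz _ H); apply Uz; now apply function_ap with a.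
Qed.

Lemma term_ap f : M f -> term_fun (ap f).
Proof. intros Mf; apply term_ap2; dfn1. Qed.

Ltac fun_rule u :=
  match goal with
  | |- definable_term (fun e => ap _ _) => apply term_ap2
  | |- definable_term (fun e => dom _) => apply (term_app dom _ term_dom)
  | |- definable_term (fun e => ran _) => apply (term_app ran _ term_ran)
  | |- definable_term (fun e => lam _ _) => apply term_lam
  | |- term_fun ?F => change (definable_term (fun e => F (e 0)))
  | H : term_fun ?F |- definable_term (fun e => ?F _) => apply (term_app F _ H)
  | |- _ => basic_rule u
  end.
Ltac dfn := repeat dfn_step fun_rule.

Ltac MM := repeat match goal with
  | |- M (?F ?x) => match goal with H : term_fun F |- _ => apply (M_fun F x H) end
  | |- M (ap _ _) => apply M_fun; [apply term_ap|]
  | |- _ => solve_M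
  end.

Lemma bijection_lam a b F : M a -> term_fun F -> (forall x, x ∈ a -> F x ∈ b) ->
  (forall x x', x ∈ a -> x' ∈ a -> F x = F x' -> x = x') ->
  (forall y, y ∈ b -> exists x, x ∈ a /\ F x = y) -> bijection (lam a F) a b.
Proof.
intros Ma HF H I S; split; [split; [now apply map_lam|]|].
- intros x x' y H1 H2; apply app_lam in H1, H2; auto; apply I; intuition congruence.
- intros y Hy; destruct (S y Hy) as (x & Hx & E); exists x; apply app_lam; auto.
Qed.

Lemma injection_lam a b F : M a -> term_fun F -> (forall x, x ∈ a -> F x ∈ b) ->
  (forall x x', x ∈ a -> x' ∈ a -> F x = F x' -> x = x') -> injection (lam a F) a b.
Proof.
intros Ma HF H I; split; [now apply map_lam|].
intros x x' y H1 H2; apply app_lam in H1, H2; auto; apply I; intuition congruence.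
Qed.

(** Bijections as definable functions on the whole universe: they compose as Rocq functions, and
    [lam] turns them into sets when needed. *)
Definition bijective (F : U -> U) (a b : U) : Prop :=
  term_fun F /\ (forall x, x ∈ a -> F x ∈ b) /\
  (forall x x', x ∈ a -> x' ∈ a -> F x = F x' -> x = x') /\
  (forall y, y ∈ b -> exists x, x ∈ a /\ F x = y).

Lemma equinumerous_bijective a b : M a ->
  (equinumerous M a b <-> exists F, bijective F a b).
Proof.
intros Ma; split.
- intros (f & Mf & [[[Hf Hm] I] S]); exists (ap f); split; [now apply term_ap|].
  split; [|split].
  + intros x Hx; apply (Hm x); now apply function_ap with a.
  + intros x x' Hx Hx' E; apply (I x x' (ap f x)); [|rewrite E]; now apply function_ap with a.
  + intros y Hy; destruct (S y Hy) as (x & Hx); exists x.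
    destruct (function_app f a x y Mf Hf Hx); auto.
- intros (F & HF & H & I & S); exists (lam a F); split; [now apply M_lam|].
  now apply bijection_lam.
Qed.

Lemma bijective_sym F a b : M a -> bijective F a b -> exists G, bijective G b a.
Proof.
intros Ma (HF & H & I & S).
pose (G := fun y => the (fun x => x ∈ a /\ F x = y)).
assert (EG : forall x, x ∈ a -> G (F x) = x).
{ intros x Hx; apply the_eq; [solve_M|auto|]; intros x' _ [Hx' E]; auto. }
exists G; split; [|split; [|split]].
- apply (term_the (fun x e => x ∈ a /\ F x = e 0)); [|dfn].
  intros e y y' _ _ _ [Hy E] [Hy' E']; apply I; congruence.
- intros y Hy; destruct (S y Hy) as (x & Hx & <-); rewrite EG; auto.
- intros y y' Hy Hy' E; destruct (S y Hy) as (x & Hx & <-).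
  destruct (S y' Hy') as (x' & Hx' & <-); rewrite !EG in E; congruence.
- intros x Hx; exists (F x); auto.
Qed.

Lemma term_comp F G : term_fun F -> term_fun G -> term_fun (fun x => F (G x)).
Proof. intros HF HG; dfn. Qed.

Lemma bijective_comp F G a b c : bijective F b c -> bijective G a b ->
  bijective (fun x => F (G x)) a c.
Proof.
intros (HF & HF1 & HF2 & HF3) (HG & HG1 & HG2 & HG3); split; [now apply term_comp|].
split; [auto|split; [auto|]].
intros z Hz; destruct (HF3 z Hz) as (y & Hy & <-); destruct (HG3 y Hy) as (x & Hx & <-); eauto.
Qed.

(* The graphs {x} × {y ∈ B : R x y} are disjoint, so they have a choice set. *)
Lemma choice A B (R : U -> U -> Prop) : M A -> M B -> definable (fun e => R (e 0) (e 1)) ->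
  (forall x, x ∈ A -> exists y, y ∈ B /\ R x y) ->
  exists F, term_fun F /\ forall x, x ∈ A -> F x ∈ B /\ R x (F x).
Proof.
intros MA MB DR H.
pose (slice := fun x => mk (fun p => exists y, y ∈ B /\ R x y /\ p = pr x y)).
assert (Sl : forall x, M x -> is_set (fun p => exists y, y ∈ B /\ R x y /\ p = pr x y)).
{ intros x Mx; assert (D : definable (fun e => R x (e 0))) by dfn.
  apply is_set_ext with (fun p => exists y, y ∈ sep B (fun y => R x y) /\ p = pr x y).
  - intros p; split; intros (y & Hy); exists y; rewrite in_sep in * by assumption; tauto.
  - apply is_set_image; [now apply M_sep|dfn]. }
assert (Tsl : term_fun slice).
{ apply (term_mk (fun p e => exists y, y ∈ B /\ R (e 0) y /\ p = pr (e 0) y)); [|dfn].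
  intros e He; apply Sl, He. }
assert (Hsl : forall x p, M x -> (p ∈ slice x <-> exists y, y ∈ B /\ R x y /\ p = pr x y)).
{ intros x p Mx; apply (in_mk (fun p => exists y, y ∈ B /\ R x y /\ p = pr x y)), Sl, Mx. }
destruct (@zfc_choice U M M_zfc (image slice A)) as (c & Mc & Hc).
- now apply M_image.
- intros X _ HX; apply in_image in HX; auto; destruct HX as (x & Hx & ->).
  destruct (H x Hx) as (y & Hy & Rxy); assert (Mx : M x) by solve_M.
  exists (pr x y); split; [solve_M|apply Hsl; eauto].
- intros X Y z _ _ Mz HX HY HzX HzY; apply in_image in HX, HY; auto.
  destruct HX as (x & Hx & ->), HY as (x' & Hx' & ->).
  assert (Mx : M x) by solve_M; assert (Mx' : M x') by solve_M.
  apply Hsl in HzX, HzY; auto; destruct HzX as (y & Hy & _ & ->), HzY as (y' & Hy' & _ & E).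
  apply pr_inj in E; solve_M || auto; destruct E; congruence.
- pose (P := fun x y => x ∈ A /\ y ∈ B /\ R x y /\ pr x y ∈ c).
  assert (HU : forall x y y', P x y -> P x y' -> y = y').
  { intros x y y' (Hx & Hy & Rxy & Hp) (_ & Hy' & Rxy' & Hp').
    assert (Mx : M x) by solve_M; assert (My : M y) by solve_M; assert (My' : M y') by solve_M.
    destruct (Hc (slice x)) as (p & _ & Up).
    - now apply M_fun.
    - apply in_image; eauto.
    - assert (E : pr x y = pr x y').
      { transitivity p; [symmetry|]; apply Up; (split; [solve_M|split; [|assumption]]);
          apply Hsl; eauto. }
      apply pr_inj in E; intuition. }
  exists (fun x => the (fun y => P x y)); split.
  + apply (term_the (fun y e => P (e 0) y)); [|unfold P; dfn]; eauto.
  + intros x Hx; assert (Mx : M x) by solve_M.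
    destruct (Hc (slice x)) as (p & (Mp & Hp & Hpc) & _).
    * now apply M_fun.
    * apply in_image; eauto.
    * apply Hsl in Hp; auto; destruct Hp as (y & Hy & Rxy & ->).
      assert (Pxy : P x y) by (unfold P; auto).
      rewrite (the_eq (fun y => P x y) y); eauto; solve_M.
Qed.

(** * Transfinite recursion *)

Section Recursion.

Variable G : U -> U.
Hypothesis term_G : term_fun G.

(** The restriction of the relation [a] to [x]. *)
Definition part (a x : U) : U := sep a (fun p => exists b, b ∈ x /\ exists z, M z /\ p = pr b z).

(** An approximation to the recursion, with downward closed domain. That it is single-valued is not
    part of the definition but comes from membership induction in [computes_fun], which also makes
    different approximations agree. *)
Definition coherent (a : U) : Prop :=
  forall x, M x -> forall y, M y -> pr x y ∈ a ->
    (forall b, b ∈ x -> exists z, M z /\ pr b z ∈ a) /\ y = G (part a x).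

Definition computes (x y : U) : Prop := exists a, M a /\ coherent a /\ pr x y ∈ a.

Definition rec (x : U) : U := the (computes x).

Lemma in_part a x p : M a -> M x ->
  (p ∈ part a x <-> p ∈ a /\ exists b, b ∈ x /\ exists z, M z /\ p = pr b z).
Proof. intros Ma Mx; apply in_sep; [exact Ma|dfn]. Qed.

Lemma definable_computes : definable (fun e => computes (e 0) (e 1)).
Proof.
assert (Tp : forall t s, definable_term t -> definable_term s ->
  definable_term (fun e => part (t e) (s e))).
{ intros t s Ht Hs; unfold part; apply term_sep; [exact Ht|].
  dfn; [exact (term_shift _ Hs)]. }
unfold computes, coherent; dfn; apply Tp; dfn.
Qed.

Lemma computes_fun x : forall y y', M x -> M y -> M y' ->
  computes x y -> computes x y' -> y = y'.
Proof.
induction (mem_wf x) as [x _ IH]; intros y y' Mx My My' (a & Ma & Ca & Ha) (a' & Ma' & Ca' & Ha').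
destruct (Ca x Mx y My Ha) as [Da ->]; destruct (Ca' x Mx y' My' Ha') as [Da' ->].
f_equal; apply mem_ext; intros p; rewrite !in_part by assumption.
split; intros (Hp & b & Hb & z & Mz & ->); (split; [|eauto]).
- destruct (Da' b Hb) as (z' & Mz' & Hz').
  rewrite (IH b Hb z z'); solve [assumption | solve_M | unfold computes; eauto].
- destruct (Da b Hb) as (z' & Mz' & Hz').
  rewrite (IH b Hb z z'); solve [assumption | solve_M | unfold computes; eauto].
Qed.

Lemma term_rec : term_fun rec.
Proof.
apply (term_the (fun y e => computes (e 0) y)).
- intros e y y' He; apply computes_fun, He.
- pose proof definable_computes; dfn.
Qed.

Lemma rec_eq x y : M x -> M y -> computes x y -> rec x = y.
Proof. intros Mx My H; apply the_eq; auto; intros y' My' H'; now apply (computes_fun x). Qed.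

Lemma computes_step x y : M x -> M y -> computes x y ->
  y = G (lam x rec) /\ forall b, b ∈ x -> computes b (rec b).
Proof.
intros Mx My (a & Ma & Ca & Ha); destruct (Ca x Mx y My Ha) as [Da E].
assert (Hb : forall b, b ∈ x -> computes b (rec b) /\ pr b (rec b) ∈ a).
{ intros b Hb; destruct (Da b Hb) as (z & Mz & Hz).
  assert (Cz : computes b z) by (unfold computes; eauto).
  rewrite (rec_eq b z); auto; solve_M. }
split; [|intros; now apply Hb].
pose proof term_rec as Tr; rewrite E; f_equal; apply mem_ext; intros p.
rewrite in_part, in_lam by assumption; split.
- intros (Hp & b & Hbx & z & Mz & ->); exists b; split; [exact Hbx|f_equal].
  symmetry; apply rec_eq; [solve_M|exact Mz|unfold computes; eauto].
- intros (b & Hbx & ->); split; [now apply Hb|].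
  exists b; split; [exact Hbx|]; exists (rec b); split; [MM|reflexivity].
Qed.

Lemma computes_rec x : ordinal x -> M x -> computes x (rec x).
Proof.
induction (mem_wf x) as [x _ IH]; intros Ox Mx.
pose proof term_rec as Tr; pose proof term_G as TG.
assert (Hb : forall b, b ∈ x -> computes b (rec b)).
{ intros b Hb; apply IH; [exact Hb|now apply ordinal_mem with x|solve_M]. }
assert (Ml : M (lam x rec)) by now apply M_lam.
pose (y := G (lam x rec)).
assert (My : M y) by (unfold y; MM).
(* The recursion below [x] extended by one point; it is coherent because an ordinal contains the
   members of its members. *)
pose (a := cup (lam x rec) (upair (pr x y) (pr x y))).
assert (Ma : M a) by (unfold a; MM).
assert (Hin : forall u v, M u -> M v ->
  (pr u v ∈ a <-> (u ∈ x /\ v = rec u) \/ (u = x /\ v = y))).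
{ intros u v Mu Mv; unfold a; rewrite in_cup, in_upair, pr_in_lam by (assumption || MM).
  split; intros [H|H]; auto; right.
  - apply pr_inj; MM; tauto.
  - destruct H; subst; auto. }
assert (Hpart : forall u, M u -> u ⊆ x -> part a u = lam u rec).
{ intros u Mu Hu; apply mem_ext; intros p; rewrite in_part, in_lam by assumption; split.
  - intros (Hp & b & Hbu & z & Mz & ->); exists b; split; [exact Hbu|f_equal].
    apply Hin in Hp; [|solve_M|exact Mz]; destruct Hp as [[_ E]|[-> _]]; [exact E|].
    destruct (mem_irrefl x); auto.
  - intros (b & Hbu & ->); split.
    + apply Hin; [solve_M|MM|auto].
    + exists b; split; [exact Hbu|]; exists (rec b); split; [MM|reflexivity]. }
assert (Cxy : computes x y).
{ exists a; split; [exact Ma|split; [|apply Hin; auto]].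
  intros u Mu v Mv Huv; apply Hin in Huv; auto; destruct Huv as [[Hu ->]|[-> ->]].
  - assert (Hux : u ⊆ x) by (intros b Hbu; now apply ordinal_trans with u).
    destruct (computes_step u (rec u) Mu Mv (Hb u Hu)) as [E _]; split.
    + intros b Hbu; exists (rec b); split; [MM|apply Hin; auto; MM].
    + rewrite Hpart; auto.
  - split.
    + intros b Hbu; exists (rec b); split; [MM|apply Hin; auto; MM].
    + rewrite Hpart; [reflexivity|auto|intros b Hbx; exact Hbx]. }
now rewrite (rec_eq x y).
Qed.

Lemma rec_spec x : ordinal x -> M x -> rec x = G (lam x rec).
Proof.
intros Ox Mx; pose proof term_rec as Tr.
apply (computes_step x (rec x) Mx); [MM|now apply computes_rec].
Qed.

End Recursion.

(** Recursion on the domain of the approximation: an empty domain yields [x0], a successor is undone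
    by [Union]. At limits the value is junk, about which nothing is claimed. *)
Lemma iteration h x0 : term_fun h -> M x0 ->
  exists F, term_fun F /\ F emptyset = x0 /\
    forall n, ordinal n -> M n -> F (succ n) = h (F n).
Proof.
intros Th Mx0.
pose (G := fun f => the (fun y => (dom f = emptyset /\ y = x0) \/
   (dom f <> emptyset /\ y = h (ap f (Union (dom f)))))).
assert (TG : term_fun G).
{ pose proof M_empty; apply (term_the (fun y f => (dom (f 0) = emptyset /\ y = x0) \/
   (dom (f 0) <> emptyset /\ y = h (ap (f 0) (Union (dom (f 0))))))).
  - intros e y y' _ _ _ H1 H2; intuition congruence.
  - unfold not; dfn. }
pose proof (term_rec G TG) as Tr.
assert (Hdom : forall x, M x -> dom (lam x (rec G)) = x).
{ intros x Mx; assert (Ml : M (lam x (rec G))) by now apply M_lam.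
  apply mem_ext; intros z; split; intros Hz.
  - assert (Mz : M z) by (apply M_mem with (dom (lam x (rec G))); [|exact Hz];
      apply (M_fun dom); [exact term_dom|exact Ml]).
    apply in_dom in Hz; auto; destruct Hz as (y & My & Hz).
    now apply pr_in_lam in Hz.
  - apply in_dom; [exact Ml|solve_M|]; exists (rec G z); split; [MM|].
    apply pr_in_lam; auto; MM. }
assert (O0 : ordinal emptyset).
{ split; [intros y Hy; destruct (in_empty _ Hy)|intros y z Hy; destruct (in_empty _ Hy)]. }
exists (rec G); split; [exact Tr|split].
- rewrite rec_spec by auto using M_empty.
  apply the_eq; rewrite ?Hdom by apply M_empty; auto.
  intros y _ H; tauto.
- intros n On Mn; rewrite rec_spec; [|exact TG|now apply ordinal_succ|solve_M].
  assert (N : succ n <> emptyset).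
  { intros E; apply (in_empty n); rewrite <- E; apply in_succ; auto. }
  assert (E : ap (lam (succ n) (rec G)) (Union (succ n)) = rec G n).
  { rewrite Union_succ by assumption; apply ap_lam; [solve_M|exact Tr|apply in_succ; auto]. }
  apply the_eq; rewrite ?Hdom, ?E by solve_M.
  + MM.
  + auto.
  + intros y _ H; tauto.
Qed.

(** * Cardinals *)

(** Zermelo's argument: [F] picks by recursion an element of [A] not yet used. If it never ran out,
    it would inject all ordinals of [M] into [A], and replacement along its inverse would make them
    a set, contradicting well-foundedness. *)
Lemma equinumerous_ordinal A : M A -> exists o, M o /\ ordinal o /\ exists F, bijective F o A.
Proof.
intros MA.
destruct (choice (sep (Pow A) (fun X => exists y, y ∈ X /\ True)) A (fun X y => y ∈ X))
  as (g & Tg & Hg).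
{ apply M_sep; [solve_M|dfn]. }
{ exact MA. }
{ dfn. }
{ intros X HX; apply in_sep in HX; [|solve_M|dfn].
  destruct HX as (HX & y & Hy & _); apply in_Pow in HX; [|exact MA].
  exists y; split; [now apply HX|exact Hy]. }
pose (rest := fun f => sep A (fun y => ~ y ∈ ran f)).
assert (Trest : term_fun rest) by (apply term_sep; dfn).
pose (F := rec (fun f => g (rest f))).
assert (TG : term_fun (fun f => g (rest f))) by now apply term_comp.
pose proof (term_rec _ TG) as TF; fold F in TF.
assert (Hrest : forall o y, M o -> (y ∈ rest (lam o F) <-> y ∈ A /\ forall b, b ∈ o -> y <> F b)).
{ intros o y Mo; assert (Ml : M (lam o F)) by now apply M_lam.
  unfold rest; rewrite in_sep; [|exact MA|pose proof term_ran; dfn].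
  split; intros [HyA Hy]; (split; [exact HyA|]); assert (My : M y) by solve_M.
  - intros b Hb ->; apply Hy, in_ran; auto; exists b; split; [solve_M|].
    apply pr_in_lam; auto; solve_M.
  - intros Hr; apply in_ran in Hr; auto; destruct Hr as (b & Mb & Hb).
    apply pr_in_lam in Hb; auto; now apply (Hy b). }
assert (HF : forall o, ordinal o -> M o -> (exists y, y ∈ rest (lam o F)) ->
  F o ∈ A /\ forall b, b ∈ o -> F o <> F b).
{ intros o Oo Mo (y & Hy); assert (Ml : M (lam o F)) by now apply M_lam.
  assert (Mr : M (rest (lam o F))) by MM.
  apply Hrest; [exact Mo|]; unfold F at 1; rewrite rec_spec by assumption; fold F.
  apply (Hg (rest (lam o F))); apply in_sep; [solve_M|dfn|].
  split; [|eauto]; apply in_Pow; [exact MA|]; split; [exact Mr|].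
  intros z Hz; now apply Hrest in Hz. }
destruct (classic (exists o, ordinal o /\ M o /\ ~ exists y, y ∈ rest (lam o F))) as [(o & H)|N].
- destruct (least (fun o => ordinal o /\ M o /\ ~ exists y, y ∈ rest (lam o F)) o H)
    as (p & (Op & Mp & Np) & Lp).
  assert (HF' : forall b, b ∈ p -> F b ∈ A /\ forall c, c ∈ b -> F b <> F c).
  { intros b Hb; assert (Ob : ordinal b) by now apply ordinal_mem with p.
    assert (Mb : M b) by solve_M; apply HF; auto.
    apply NNPP; intros Nb; apply (Lp b Hb); auto. }
  exists p; split; [exact Mp|split; [exact Op|exists F]].
  split; [exact TF|split; [apply HF'|split]].
  + intros x x' Hx Hx' E; destruct (proj2 Op x x' Hx Hx') as [I|[I|I]]; auto; exfalso.
    * apply (proj2 (HF' x' Hx') x I); auto.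
    * apply (proj2 (HF' x Hx) x' I); auto.
  + intros y Hy; apply NNPP; intros Ny; apply Np; exists y; apply Hrest; auto.
    split; [exact Hy|]; intros b Hb ->; apply Ny; eauto.
- exfalso.
  assert (HF' : forall b, ordinal b -> M b -> F b ∈ A /\ forall c, c ∈ b -> F b <> F c).
  { intros b Ob Mb; apply HF; auto; apply NNPP; intros Nb; apply N; eauto. }
  assert (HI : forall x x', ordinal x -> ordinal x' -> M x -> M x' -> F x = F x' -> x = x').
  { intros x x' Ox Ox' Mx Mx' E; destruct (ordinal_trichotomy x x' Ox Ox') as [I|[I|I]]; auto.
    - destruct (proj2 (HF' x' Ox' Mx') x I); auto.
    - destruct (proj2 (HF' x Ox Mx) x' I); auto. }
  destruct (is_set_repl A (fun y o => ordinal o /\ F o = y) MA) as (s & Ms & Hs).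
  + dfn.
  + intros x y y' _ My My' [Oy E] [Oy' E']; apply HI; auto; congruence.
  + assert (Hs' : forall o, o ∈ s <-> M o /\ ordinal o).
    { intros o; rewrite Hs; split; [intros (Mo & x & _ & Oo & _); auto|].
      intros [Mo Oo]; split; [exact Mo|]; exists (F o); split; [now apply HF'|auto]. }
    apply (mem_irrefl s), Hs'; split; [exact Ms|].
    apply ordinal_of_ordinals; [|intros x Hx; now apply Hs'].
    intros y Hy z Hz; apply Hs' in Hy; destruct Hy as [My Oy]; apply Hs'.
    split; [solve_M|now apply ordinal_mem with y].
Qed.

Lemma cardinality_exists A : M A -> exists m, M m /\ cardinality M A m.
Proof.
intros MA; destruct (equinumerous_ordinal A MA) as (o & Mo & Oo & F & HF).
destruct (least (fun o => M o /\ ordinal o /\ exists F, bijective F o A) o)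
  as (m & (Mm & Om & G & HG) & Lm); [eauto 6|].
exists m; split; [exact Mm|split; [split; [exact Om|]|]].
- intros x Hx Ex; assert (Mx : M x) by solve_M.
  apply equinumerous_bijective in Ex; [|exact Mx]; destruct Ex as (H & HH).
  apply (Lm x Hx); split; [exact Mx|split; [now apply ordinal_mem with m|]].
  exists (fun z => G (H z)); now apply bijective_comp with m.
- apply equinumerous_bijective; [exact MA|]; now apply bijective_sym with (F := G).
Qed.

(* The least code of each element is an injection. *)
Lemma card_le_image P m H : M P -> M m -> ordinal m -> equinumerous M P m -> term_fun H ->
  card_le M (image H P) m.
Proof.
intros MP Mm Om HP TH; apply equinumerous_bijective in HP; [|exact MP].
destruct HP as (g & Tg & Hg & Ig & Sg).
pose (code := fun y n => n ∈ m /\ exists x, x ∈ P /\ g x = n /\ H x = y).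
pose (lc := fun y n => code y n /\ forall n', n' ∈ n -> ~ code y n').
assert (U1 : forall y n n', lc y n -> lc y n' -> n = n').
{ intros y n n' [Hn Ln] [Hn' Ln'].
  destruct (proj2 Om n n' (proj1 Hn) (proj1 Hn')) as [I|[I|I]]; auto; exfalso.
  - exact (Ln' n I Hn).
  - exact (Ln n' I Hn'). }
pose (J := fun y => the (fun n => lc y n)).
assert (TJ : term_fun J).
{ apply (term_the (fun n e => lc (e 0) n)); [eauto|unfold lc, code; dfn]. }
assert (HJ : forall y, y ∈ image H P -> lc y (J y)).
{ intros y Hy; apply in_image in Hy; auto; destruct Hy as (x & Hx & ->).
  destruct (least (code (H x)) (g x)) as (n & Hn & Ln).
  - split; [auto|eauto].
  - assert (L : lc (H x) n) by (split; auto).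
    assert (Mn : M n) by (destruct Hn; solve_M).
    assert (E : J (H x) = n) by (apply the_eq; eauto).
    now rewrite E. }
exists (lam (image H P) J); split; [apply M_lam; [now apply M_image|exact TJ]|].
apply injection_lam; [now apply M_image|exact TJ| |].
- intros y Hy; now destruct (HJ y Hy) as [[? _] _].
- intros y y' Hy Hy' E; destruct (HJ y Hy) as [[_ (x & Hx & E1 & <-)] _].
  destruct (HJ y' Hy') as [[_ (x' & Hx' & E1' & <-)] _].
  f_equal; apply Ig; congruence.
Qed.

(** The filter is a base of itself, so some cardinality of a base exists, and membership being
    well-founded there is a least one. *)
Lemma cf_Club_exists k : M k -> exists m, M m /\ cf_Club M k m.
Proof.
intros Mk.
pose (F0 := sep (Pow k) (fun a => exists c, M c /\ (club k c /\ c ⊆ a))).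
assert (D : definable (fun e => exists c, M c /\ (club k c /\ c ⊆ e 0))) by dfn.
assert (MF0 : M F0) by (apply M_sep; [solve_M|exact D]).
assert (HF0 : forall a, a ∈ F0 <-> Club M k a).
{ intros a; unfold F0; rewrite in_sep, in_Pow by solve_M || exact D.
  unfold Club; tauto. }
assert (BF0 : Club_base M k F0).
{ split; [intros a; apply HF0|]; intros a Ha; exists a; split; [now apply HF0|].
  intros z Hz; exact Hz. }
destruct (cardinality_exists F0 MF0) as (m0 & Mm0 & Hm0).
destruct (least (fun m => M m /\ exists F, M F /\ Club_base M k F /\ cardinality M F m) m0)
  as (m & (Mm & Hm) & Lm); [eauto 8|].
exists m; split; [exact Mm|split; [exact Hm|]].
intros F n MF Mn BF HF Hn; apply (Lm n Hn); eauto.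
Qed.

Lemma ordinal_subset (a b : U) : ordinal a -> ordinal b -> a ⊆ b -> a ∈ b \/ a = b.
Proof.
intros Oa Ob H; apply ordinal_nmem; [exact Ob|exact Oa|now apply ordinal_subset_nmem].
Qed.

Lemma ordinal_subset_mem (a b c : U) : ordinal a -> ordinal c -> a ⊆ b -> b ∈ c -> a ∈ c.
Proof.
intros Oa Oc H Hb; assert (Ob : ordinal b) by now apply ordinal_mem with c.
destruct (ordinal_subset a b Oa Ob H) as [H'| ->]; [now apply ordinal_trans with b|exact Hb].
Qed.

Lemma empty_in_limit k : limit_ordinal k -> emptyset ∈ k.
Proof.
intros (Ok & (x & Hx) & _); destruct (least (fun y => y ∈ k) x Hx) as (y & Hy & Ly).
replace emptyset with y; [exact Hy|].
apply mem_ext; intros z; split; intros Hz.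
- destruct (Ly z Hz); now apply ordinal_trans with y.
- destruct (in_empty _ Hz).
Qed.

(** An element of omega is not a limit, so if nonempty it has a greatest member and is a successor.
    [P] may be any Rocq predicate, since the induction is on membership in the universe. *)
Lemma omega_ind w (P : U -> Prop) : M w -> is_omega w -> P emptyset ->
  (forall n, n ∈ w -> P n -> P (succ n)) -> forall n, n ∈ w -> P n.
Proof.
intros Mw [Lw Nw] P0 PS n; induction (mem_wf n) as [n _ IH]; intros Hn.
assert (Mn : M n) by solve_M.
assert (On : ordinal n) by now apply ordinal_mem with w; [apply Lw|].
destruct (classic (exists y, y ∈ n)) as [E|E].
- destruct (classic (forall y, y ∈ n -> exists z, z ∈ n /\ y ∈ z)) as [L|L].
  + destruct (Nw n Hn); split; auto.
  + apply not_all_ex_not in L; destruct L as (y & L).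
    apply imply_to_and in L; destruct L as [Hy L].
    assert (Hyw : y ∈ w) by (apply ordinal_trans with n; [apply Lw|assumption..]).
    assert (My : M y) by solve_M.
    replace n with (succ y); [now apply PS; [|apply IH]|].
    apply mem_ext; intros z; rewrite in_succ by exact My; split.
    * intros [Hz| ->]; [now apply ordinal_trans with y|exact Hy].
    * intros Hz; destruct (proj2 On z y Hz Hy) as [H|[H|H]]; auto.
      destruct L; eauto.
- replace n with emptyset; [exact P0|].
  apply mem_ext; intros z; split; intros Hz; [destruct (in_empty _ Hz)|destruct E; eauto].
Qed.

(** * Cofinalities and club sets *)

(** Minimality of the cofinality: an unbounded image would be that of a cofinal map from an ordinal
    below [t]. With [t] equal to [k] this is regularity. *)
Lemma bounded_image k t s F : M t -> cofinality M k t -> s ∈ t -> term_fun F ->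
  (forall x, x ∈ s -> F x ∈ k) -> exists b, b ∈ k /\ forall x, x ∈ s -> F x ∈ b.
Proof.
intros Mt (Ok & Ot & _ & Hmin) Hs TF HF; assert (Ms : M s) by solve_M.
apply NNPP; intros N; apply (Hmin s Hs).
exists (lam s F); split; [now apply M_lam|split; [now apply map_lam|]].
intros b Hb; apply NNPP; intros N'; apply N; exists b; split; [exact Hb|].
intros x Hx; apply NNPP; intros Nx; apply N'; exists (F x); split; [|exact Nx].
exists x; now apply app_lam.
Qed.

(** The witnesses may equal [a], which suits sequences that are only weakly increasing: if [a] were
    outside [c], they would all be smaller and [a] a limit of [c]. The first existence hypothesis
    excludes an empty [a]. *)
Lemma closed_sup (k c a : U) : ordinal k -> club k c -> a ∈ k ->
  (exists x, x ∈ c /\ (x ∈ a \/ x = a)) ->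
  (forall y, y ∈ a -> exists x, x ∈ c /\ (x ∈ a \/ x = a) /\ y ∈ x) -> a ∈ c.
Proof.
intros Ok (_ & _ & C) Ha (x0 & Hx0 & E0) H.
destruct (classic (a ∈ c)) as [Hac|Hac]; [exact Hac|].
assert (Oa : ordinal a) by now apply ordinal_mem with k.
assert (H' : forall y, y ∈ a -> exists x, x ∈ c /\ x ∈ a /\ y ∈ x).
{ intros y Hy; destruct (H y Hy) as (x & Hx & [Hxa| ->] & Hyx); [eauto|tauto]. }
apply C; [exact Ha| |].
- split; [exact Oa|split].
  + exists x0; destruct E0 as [E0| ->]; [exact E0|tauto].
  + intros y Hy; destruct (H' y Hy) as (x & Hx & Hxa & Hyx); eauto.
- intros y Hy; destruct (H' y Hy) as (x & Hx & Hxa & Hyx).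
  exists x; split; [auto|now apply mem_asym].
Qed.

(** * Diagonal intersections along a continuous, weakly increasing cofinal sequence *)

Section Diagonal.

Variables (k t w : U) (K E : U -> U).
Hypotheses (Mk : M k) (Mt : M t) (Lk : limit_ordinal k) (Lt : limit_ordinal t).
Hypotheses (Ow : is_omega w) (Hw : w ∈ t) (cof_k : cofinality M k t).
Hypotheses (term_K : term_fun K) (K_in : forall j, j ∈ t -> K j ∈ k).
Hypothesis K_mono : forall i j, j ∈ t -> i ∈ j -> K i ⊆ K j.
Hypothesis K_cont : forall d y, d ∈ t -> limit_ordinal d -> y ∈ K d ->
  exists i, i ∈ d /\ y ∈ K i.
Hypothesis K_cof : forall b, b ∈ k -> exists j, j ∈ t /\ b ∈ K j.
Hypotheses (term_E : term_fun E) (E_club : forall i, i ∈ t -> club k (E i)).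

Let Ok : ordinal k := proj1 Lk.
Let Ot : ordinal t := proj1 Lt.

Lemma K_mono_subset i j : i ∈ t -> j ∈ t -> i ⊆ j -> K i ⊆ K j.
Proof.
intros Hi Hj H.
destruct (ordinal_subset i j) as [I| ->]; eauto using ordinal_mem.
intros z Hz; exact Hz.
Qed.

Definition diagonal : U := sep t (fun j => forall i, i ∈ j -> K j ∈ E i).

Lemma in_diagonal j : j ∈ diagonal <-> j ∈ t /\ forall i, i ∈ j -> K j ∈ E i.
Proof. apply in_sep; [exact Mt|dfn]. Qed.

(** For [i] below [d], the points [x] of the diagonal between [i] and [d] have [K x] in [E i]; by
    continuity these values reach up to [K d], so [K d] is in [E i]. *)
Lemma diagonal_closed : closed t diagonal.
Proof.
intros d Hd Ld H; apply in_diagonal; split; [exact Hd|]; intros i Hi.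
assert (Md : M d) by solve_M.
assert (Hit : i ∈ t) by now apply ordinal_trans with d.
assert (G : forall j, j ∈ d -> exists x, x ∈ d /\ j ∈ x /\ K x ∈ E i).
{ intros j Hj; destruct (ordinal_max d i j (proj1 Ld) Hi Hj) as (z & Hz & Hiz & Hjz).
  destruct (H (succ z)) as (x & [HxD Hx] & Hzx); [now apply limit_succ|].
  assert (Mz : M z) by solve_M.
  assert (Ox : ordinal x) by (apply ordinal_mem with d; [apply Ld|exact Hx]).
  assert (Oz : ordinal z) by (apply ordinal_mem with d; [apply Ld|exact Hz]).
  assert (Hz' : z ∈ x).
  { apply (ordinal_nmem_subset x (succ z)); auto.
    - now apply ordinal_succ.
    - apply in_succ; auto. }
  exists x; split; [exact Hx|split].
  - apply ordinal_subset_mem with z; auto; apply ordinal_mem with d; [apply Ld|exact Hj].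
  - apply in_diagonal in HxD; apply HxD, ordinal_subset_mem with z; auto.
    now apply ordinal_mem with t. }
assert (Kd : forall x, x ∈ d -> K x ∈ K d \/ K x = K d).
{ intros x Hx; apply ordinal_subset.
  - apply ordinal_mem with k; auto; apply K_in; now apply ordinal_trans with d.
  - apply ordinal_mem with k; auto.
  - now apply K_mono. }
apply closed_sup with k; auto.
- destruct (G i Hi) as (x & Hx & _ & HE); eauto.
- intros y Hy; destruct (K_cont d y Hd Ld Hy) as (j & Hj & Hyj).
  destruct (G j Hj) as (x & Hx & Hjx & HE); exists (K x); split; [exact HE|].
  split; [auto|]; apply (K_mono j x); auto; now apply ordinal_trans with d.
Qed.

(** Above [K j] choose one point of each [E i] with [i] below [j]. There are fewer than the
    cofinality of [k] many, so they are bounded, and some later value of [K] exceeds them all. *)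
Lemma diagonal_step : exists h, term_fun h /\ forall j, j ∈ t ->
  h j ∈ t /\ (j ∈ h j /\ forall i, i ∈ j -> exists x, x ∈ E i /\ (~ x ∈ K j /\ x ∈ K (h j))).
Proof.
apply choice with (R := fun j j' =>
  j ∈ j' /\ forall i, i ∈ j -> exists x, x ∈ E i /\ (~ x ∈ K j /\ x ∈ K j')); auto.
{ dfn. }
intros j Hj; assert (Mj : M j) by solve_M.
assert (MKj : M (K j)) by MM.
destruct (choice j k (fun i x => x ∈ E i /\ ~ x ∈ K j)) as (F & TF & HF); auto.
{ dfn. }
{ intros i Hi; assert (Hit : i ∈ t) by now apply ordinal_trans with j.
  destruct (E_club i Hit) as (Es & Eu & _).
  destruct (Eu (K j) (K_in j Hj)) as (x & Hx & N); exists x; auto. }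
destruct (bounded_image k t j F) as (b & Hb & Fb); auto.
{ intros x Hx; now apply HF. }
destruct (K_cof b Hb) as (j1 & Hj1 & Hbj).
destruct (ordinal_max t (succ j) j1 Ot) as (z & Hz & Hjz & H1z); auto.
{ now apply limit_succ. }
assert (Hjz' : j ∈ z) by (apply Hjz, in_succ; auto).
exists z; split; [exact Hz|split; [exact Hjz'|]].
intros i Hi; destruct (HF i Hi) as (_ & HE & HN).
exists (F i); split; [exact HE|split; [exact HN|]].
apply (K_mono_subset j1 z); auto.
apply ordinal_trans with b; auto; apply ordinal_mem with k; auto.
Qed.

(* The supremum of the orbit of [x0] under [diagonal_step] is in the diagonal. *)
Lemma diagonal_unbounded : unbounded t (fun j => j ∈ diagonal).
Proof.
intros x0 Hx0; assert (Mx0 : M x0) by solve_M; assert (Mw : M w) by solve_M.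
destruct diagonal_step as (h & Th & Hh).
destruct (iteration h x0 Th Mx0) as (I & TI & I0 & IS).
assert (Lw := proj1 Ow).
assert (IS' : forall n, n ∈ w -> I (succ n) = h (I n)).
{ intros n Hn; apply IS; [apply ordinal_mem with w; [apply Lw|exact Hn]|solve_M]. }
assert (It : forall n, n ∈ w -> I n ∈ t).
{ apply omega_ind; auto; [now rewrite I0|].
  intros n Hn Hin; rewrite IS' by exact Hn; now apply Hh. }
pose (d := Union (image I w)).
assert (MI : M (image I w)) by now apply M_image.
assert (Md : M d) by (unfold d; solve_M).
assert (Hd : forall y, y ∈ d <-> exists n, n ∈ w /\ y ∈ I n).
{ intros y; unfold d; rewrite in_Union by exact MI; split.
  - intros (z & Hz & Hy); apply in_image in Hz; auto; destruct Hz as (n & Hn & ->); eauto.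
  - intros (n & Hn & Hy); exists (I n); split; [apply in_image; eauto|exact Hy]. }
assert (HId : forall n, n ∈ w -> I n ∈ d).
{ intros n Hn; apply Hd; exists (succ n); split; [now apply limit_succ|].
  rewrite IS' by exact Hn; apply Hh; auto. }
assert (Od : ordinal d).
{ apply ordinal_Union; [exact MI|]; intros x Hx; apply in_image in Hx; auto.
  destruct Hx as (n & Hn & ->); apply ordinal_mem with t; auto. }
assert (Hx0d : x0 ∈ d).
{ rewrite <- I0; apply HId, empty_in_limit, Lw. }
assert (Ld : limit_ordinal d).
{ split; [exact Od|split; [eauto|]].
  intros y Hy; apply Hd in Hy; destruct Hy as (n & Hn & Hy); eauto. }
(* Here [t] being uncountable matters: the countably many values [K (I n)] are bounded in [k], so
   the orbit stays below some [j] in [t]. *)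
assert (Hdt : d ∈ t).
{ destruct (bounded_image k t w (fun n => K (I n))) as (b & Hb & Fb); auto.
  { now apply term_comp. }
  destruct (K_cof b Hb) as (j & Hj & Hbj).
  apply ordinal_subset_mem with j; auto.
  intros y Hy; apply Hd in Hy; destruct Hy as (n & Hn & Hy).
  assert (Oj : ordinal j) by now apply ordinal_mem with t.
  assert (OI : ordinal (I n)) by (apply ordinal_mem with t; auto).
  destruct (classic (I n ∈ j)) as [Hj'|Hj']; [now apply ordinal_trans with (I n)|].
  exfalso; apply (mem_asym b (K (I n))); [|auto].
  apply (K_mono_subset j (I n)); auto; now apply ordinal_nmem_subset. }
exists d; split; [|now apply mem_asym].
apply in_diagonal; split; [exact Hdt|]; intros i Hi.
assert (Hit : i ∈ t) by now apply ordinal_trans with d.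
assert (OKd : ordinal (K d)) by (apply ordinal_mem with k; auto).
(* Once the orbit has passed [i], each step puts a point of [E i] between consecutive values of [K];
   so points of [E i] reach up to [K d]. *)
assert (G : forall j, j ∈ d -> exists x, x ∈ E i /\ K j ⊆ x /\ x ∈ K d).
{ intros j Hj; destruct (ordinal_max d i j Od Hi Hj) as (z & Hz & Hiz & Hjz).
  assert (Hjt : j ∈ t) by now apply ordinal_trans with d.
  apply Hd in Hz; destruct Hz as (n & Hn & Hz).
  assert (OI : ordinal (I n)) by (apply ordinal_mem with t; auto).
  assert (HiI : i ∈ I n) by (apply ordinal_subset_mem with z; auto; now apply ordinal_mem with t).
  assert (HjI : j ∈ I n) by (apply ordinal_subset_mem with z; auto; now apply ordinal_mem with t).
  destruct (proj2 (proj2 (Hh (I n) (It n Hn))) i HiI) as (x & HxE & HxN & Hx).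
  rewrite <- IS' in Hx by exact Hn.
  assert (Ox : ordinal x).
  { apply ordinal_mem with (K (I (succ n))); [|exact Hx].
    apply ordinal_mem with k; auto; apply K_in, It; now apply limit_succ. }
  exists x; split; [exact HxE|split].
  - intros y Hy; apply (K_mono j (I n)) in Hy; auto.
    revert y Hy; apply ordinal_nmem_subset; auto.
    apply ordinal_mem with k; auto.
  - apply (K_mono (I (succ n)) d); auto; apply HId; now apply limit_succ. }
apply closed_sup with k; auto.
- destruct (G i Hi) as (x & HxE & _ & Hx); eauto.
- intros y Hy; destruct (K_cont d y Hdt Ld Hy) as (j & Hj & Hyj).
  destruct (G j Hj) as (x & HxE & HxK & Hx); exists x; auto.
Qed.

Lemma diagonal_club : M diagonal /\ club t diagonal.
Proof.
split; [apply M_sep; [exact Mt|dfn]|].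
split; [intros j Hj; now apply in_diagonal in Hj|].
split; [exact diagonal_unbounded|exact diagonal_closed].
Qed.

End Diagonal.

Lemma club_full (k : U) : limit_ordinal k -> club k k.
Proof.
intros (Ok & _ & L); split; [intros z Hz; exact Hz|split].
- intros x Hx; exists x; split; [exact Hx|apply mem_irrefl].
- intros d Hd _ _; exact Hd.
Qed.

(* Diagonal intersection of the clubs in [b], along an injection of [b] into [k]. *)
Lemma almost_lower_bound k b : M k -> regular M k -> gt_aleph0 k -> M b -> card_le M b k ->
  exists E, M E /\ club k E /\
    forall X, X ∈ b -> club k X -> exists s, s ∈ k /\ forall y, y ∈ E -> ~ y ∈ X -> y ∈ s.
Proof.
intros Mk (_ & Lk & cof) (w & Ow & Hw) Mb (f & Mf & [[Hf Hmap] Hinj]).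
(* The club in [b] with code [i]; if there is none, the condition is void and [E i] is all of [k],
   still a club. *)
pose (E := fun i => sep k (fun x => forall X, X ∈ b -> club k X -> pr X i ∈ f -> x ∈ X)).
assert (TE : term_fun E) by (apply term_sep; dfn).
assert (DE : forall i, M i ->
  definable (fun e => forall X, X ∈ b -> club k X -> pr X i ∈ f -> e 0 ∈ X)) by (intros; dfn).
assert (HE : forall i X, X ∈ b -> club k X -> M i -> pr X i ∈ f -> E i = X).
{ intros i X HX CX Mi Hp; assert (MX : M X) by solve_M.
  apply mem_ext; intros z; unfold E; rewrite in_sep by auto; split.
  - intros [_ H]; auto.
  - intros Hz; split; [now apply CX|]; intros Y HY CY Hq; assert (MY : M Y) by solve_M.
    replace Y with X; [exact Hz|]; apply (Hinj X Y i); now apply app_eq. }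
assert (CE : forall i, i ∈ k -> club k (E i)).
{ intros i Hi; assert (Mi : M i) by solve_M.
  destruct (classic (exists X, X ∈ b /\ club k X /\ pr X i ∈ f)) as [(X & HX & CX & Hp)|N].
  - rewrite (HE i X); auto.
  - replace (E i) with k; [now apply club_full|].
    apply mem_ext; intros z; unfold E; rewrite in_sep by auto; split; [|tauto].
    intros Hz; split; [exact Hz|]; intros X HX CX Hp; destruct N; eauto. }
assert (Tid : term_fun (fun x => x)) by (unfold term_fun; dfn).
destruct (diagonal_club k k w (fun x => x) E) as [MD CD]; auto.
- intros i j Hj Hi; intros z Hz; apply ordinal_trans with i; auto.
  apply ordinal_mem with k; [apply Lk|exact Hj].
- intros d y _ Ld Hy; now apply Ld.
- intros x Hx; destruct (proj2 (proj2 Lk) x Hx) as (y & Hy & Hxy); eauto.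
- exists (diagonal k (fun x => x) E); split; [exact MD|split; [exact CD|]].
  intros X HX CX; assert (MX : M X) by solve_M.
  pose proof (function_ap f b X Mf Hf HX) as Hi.
  destruct (app_M _ _ _ Mf Hi) as [_ Mi].
  assert (Hik : ap f X ∈ k) by now apply (Hmap X).
  (* A point of the diagonal above the code of [X] lies in [X], so the exceptions are at most that
     code. *)
  exists (succ (ap f X)); split; [now apply limit_succ|].
  intros y Hy HyX; apply in_diagonal in Hy; auto; destruct Hy as [Hyk Hy].
  apply in_succ; [exact Mi|].
  destruct (ordinal_trichotomy (ap f X) y) as [H|[H|H]]; auto.
  + apply ordinal_mem with k; auto; apply Lk.
  + apply ordinal_mem with k; auto; apply Lk.
  + destruct HyX; rewrite <- (HE (ap f X) X); auto; now apply app_eq.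
Qed.

(** If [t] had a last element [i], the values below [i] would be bounded by minimality of [t], and
    the maximum of this bound and the value at [i] would bound the cofinal map in the limit [k]. *)
Lemma cofinality_limit k t : M k -> M t -> limit_ordinal k -> cofinality M k t -> limit_ordinal t.
Proof.
intros Mk Mt Lk cof; assert (cof' := cof).
destruct cof as (_ & Ot & (f & Mf & [[Hf Hm] Hu]) & _).
pose proof (term_ap f Mf) as Tf.
assert (Hft : forall x, x ∈ t -> ap f x ∈ k).
{ intros x Hx; apply (Hm x); now apply function_ap with t. }
split; [exact Ot|split].
- destruct (Hu emptyset) as (y & (x & Hxy) & _); [now apply empty_in_limit|].
  exists x; now apply (function_app f t x y Mf Hf).
- intros i Hi; apply NNPP; intros N.
  assert (Hti : forall z, z ∈ t -> z ∈ i \/ z = i).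
  { intros z Hz; destruct (proj2 Ot z i Hz Hi) as [H|[H|H]]; auto; destruct N; eauto. }
  destruct (bounded_image k t i (ap f)) as (b & Hb & Fb); auto.
  { intros x Hx; apply Hft; now apply ordinal_trans with i. }
  destruct (ordinal_max k b (ap f i) (proj1 Lk) Hb (Hft i Hi)) as (z & Hz & Hbz & Hiz).
  assert (Mz : M z) by solve_M.
  destruct (Hu (succ z)) as (y & (x & Hxy) & Hy); [now apply limit_succ|].
  apply Hy, in_succ; [exact Mz|].
  apply (function_app f t) in Hxy; auto; destruct Hxy as [Hx ->].
  destruct (Hti x Hx) as [Hxi| ->]; [left; auto|].
  apply ordinal_subset; auto; apply ordinal_mem with k; auto; apply Lk.
Qed.

(** [K j] is the supremum of the values of a cofinal map at arguments below [j]. This makes [K]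
    weakly increasing and continuous at once; it stays below [k] by minimality of [t]. *)
Lemma continuous_cofinal k t : M k -> M t -> limit_ordinal k -> cofinality M k t ->
  exists K, term_fun K /\ (forall j, j ∈ t -> K j ∈ k) /\
    (forall i j, j ∈ t -> i ∈ j -> K i ⊆ K j) /\
    (forall d y, d ∈ t -> limit_ordinal d -> y ∈ K d -> exists i, i ∈ d /\ y ∈ K i) /\
    (forall b, b ∈ k -> exists j, j ∈ t /\ b ∈ K j).
Proof.
intros Mk Mt Lk cof; assert (Lt := cofinality_limit k t Mk Mt Lk cof).
assert (cof' := cof); destruct cof as (_ & Ot & (f & Mf & [[Hf Hm] Hu]) & _).
pose proof (term_ap f Mf) as Tf.
assert (Hft : forall x, x ∈ t -> ap f x ∈ k).
{ intros x Hx; apply (Hm x); now apply function_ap with t. }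
pose (K := fun j => Union (image (ap f) j)).
assert (TK : term_fun K) by (unfold term_fun, K; dfn).
assert (HK : forall j y, M j -> (y ∈ K j <-> exists i, i ∈ j /\ y ∈ ap f i)).
{ intros j y Mj; unfold K; rewrite in_Union by (now apply M_image); split.
  - intros (z & Hz & Hy); apply in_image in Hz; auto; destruct Hz as (i & Hi & ->); eauto.
  - intros (i & Hi & Hy); exists (ap f i); split; [apply in_image; eauto|exact Hy]. }
exists K; split; [exact TK|split; [|split; [|split]]].
- intros j Hj; assert (Mj : M j) by solve_M.
  assert (Hjt : forall x, x ∈ j -> ap f x ∈ k).
  { intros x Hx; apply Hft; now apply ordinal_trans with j. }
  destruct (bounded_image k t j (ap f)) as (b & Hb & Fb); auto.
  apply ordinal_subset_mem with b; auto; [|apply Lk|].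
  + apply ordinal_Union; [now apply M_image|].
    intros x Hx; apply in_image in Hx; auto; destruct Hx as (i & Hi & ->).
    apply ordinal_mem with k; [apply Lk|auto].
  + intros y Hy; apply HK in Hy; auto; destruct Hy as (i & Hi & Hy).
    apply ordinal_trans with (ap f i); auto; apply ordinal_mem with k; [apply Lk|exact Hb].
- intros i j Hj Hi y Hy; assert (Mj : M j) by solve_M; assert (Mi : M i) by solve_M.
  apply HK in Hy; auto; apply HK; auto; destruct Hy as (x & Hx & Hy).
  exists x; split; [|exact Hy]; apply ordinal_trans with i; auto; now apply ordinal_mem with t.
- intros d y Hd Ld Hy; assert (Md : M d) by solve_M.
  apply HK in Hy; auto; destruct Hy as (i & Hi & Hy); assert (Mi : M i) by solve_M.
  exists (succ i); split; [now apply limit_succ|].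
  apply HK; [solve_M|]; exists i; split; [apply in_succ; auto|exact Hy].
- intros b Hb; assert (Mb : M b) by solve_M.
  destruct (Hu (succ b)) as (y & (x & Hxy) & Hy); [now apply limit_succ|].
  apply (function_app f t) in Hxy; auto; destruct Hxy as [Hx ->]; assert (Mx : M x) by solve_M.
  exists (succ x); split; [now apply limit_succ|].
  apply HK; [solve_M|]; exists x; split; [apply in_succ; auto|].
  apply (ordinal_nmem_subset _ (succ b)) in Hy.
  + apply Hy, in_succ; auto.
  + apply ordinal_mem with k; [apply Lk|auto].
  + apply ordinal_mem with k; [apply Lk|now apply limit_succ].
Qed.

(** [Ks] stands for the clubs of V1. The covering hypothesis already supplies an almost lower bound
    for each covering set, so the argument runs inside a single model. *)
Lemma uncountable_case k t Ks : M k -> M t -> limit_ordinal k -> cofinality M k t ->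
  gt_aleph0 t -> M Ks -> (forall c, c ∈ Ks -> club k c) ->
  (forall mu a, M mu -> M a -> cf_Club M t mu -> card_le M a mu -> a ⊆ Ks ->
     exists b, M b /\ function_on b t /\
       (forall i B, app b i B -> exists E, E ∈ Ks /\
          forall X, X ∈ B -> X ∈ Ks -> exists s, s ∈ k /\ forall y, y ∈ E -> ~ y ∈ X -> y ∈ s) /\
       (forall X, X ∈ a -> exists i B, app b i B /\ X ∈ B)) ->
  exists C, M C /\ C ⊆ k /\ unbounded k (fun x => x ∈ C) /\
    forall E, E ∈ Ks -> bounded k (fun x => x ∈ C /\ ~ x ∈ E).
Proof.
intros Mk Mt Lk cof (w & Ow & Hw) MKs HKs cover.
assert (Lt := cofinality_limit k t Mk Mt Lk cof).
assert (Ok := proj1 Lk); assert (Ot := proj1 Lt).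
destruct (continuous_cofinal k t Mk Mt Lk cof) as (K & TK & K_in & K_mono & K_cont & K_cof).
destruct (cf_Club_exists t Mt) as (mu & Mmu & Hmu).
assert (Hmu' := Hmu); destruct Hmu' as ((B & MB & BB & HB) & _).
apply NNPP; intros N.
destruct (choice B Ks (fun e E => forall x, x ∈ k -> exists y, y ∈ image K e /\ (~ y ∈ E /\ ~ y ∈ x)))
  as (bad & Tbad & Hbad); auto.
{ dfn. }
{ intros e He; assert (Me : M e) by solve_M.
  apply NNPP; intros N'; apply N; exists (image K e).
  destruct (proj1 BB e He) as (_ & Het & c & Mc & (Hc & Hcu & _) & Hce).
  split; [now apply M_image|split; [|split]].
  - intros y Hy; apply in_image in Hy; auto; destruct Hy as (j & Hj & ->); auto.
  - intros x Hx; destruct (K_cof x Hx) as (j & Hj & Hxj).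
    destruct (Hcu j Hj) as (i & Hi & Hij); assert (Hit : i ∈ t) by auto.
    exists (K i); split; [apply in_image; eauto|].
    assert (HK : K j ⊆ K i).
    { apply (K_mono_subset t K); auto.
      apply ordinal_nmem_subset; auto; now apply ordinal_mem with t. }
    now apply mem_asym, HK.
  - intros E HE; apply NNPP; intros NE; apply N'; exists E; split; [exact HE|].
    intros x Hx; apply NNPP; intros Nx; apply NE; exists x; split; [exact Hx|].
    intros y [Hy HyE]; apply NNPP; intros Hyx; apply Nx; eauto. }
(* The base [B] has [mu] elements, hence its image under [bad] has at most [mu]. *)
destruct (cover mu (image bad B)) as (b & Mb & Hb & Hlow & Hcov); auto.
{ now apply M_image. }
{ apply card_le_image; auto; apply HB. }
{ intros X HX; apply in_image in HX; auto; destruct HX as (e & He & ->); now apply Hbad. }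
pose proof (term_ap b Mb) as Tb.
destruct (choice t Ks (fun i E => forall X, X ∈ Ks -> X ∈ ap b i ->
    exists s, s ∈ k /\ forall y, y ∈ E -> ~ y ∈ X -> y ∈ s)) as (low & Tlow & Hl); auto.
{ dfn. }
{ intros i Hi; destruct (Hlow i (ap b i)) as (E & HE & HX); [now apply function_ap with t|].
  exists E; auto. }
destruct (diagonal_club k t w K low) as [MD CD]; auto.
{ intros i Hi; now apply HKs, Hl. }
destruct (proj2 BB (diagonal t K low)) as (e & He & HeD).
{ split; [exact MD|split; [apply CD|]]; exists (diagonal t K low).
  split; [exact MD|split; [exact CD|]]; intros z Hz; exact Hz. }
assert (Me : M e) by solve_M.
destruct (Hbad e He) as [HbK Hbe].
destruct (Hcov (bad e)) as (i & Bi & HiB & HX); [apply in_image; eauto|].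
apply (function_app b t) in HiB; auto; destruct HiB as [Hi ->].
destruct (proj2 (Hl i Hi) (bad e) HbK HX) as (s & Hs & Hsb).
(* The bound [z] covers both kinds of exception: for [j] above [i], [K j] is in [low i], so outside
   [bad e] only below [s]; for [j] up to [i], [K j] is at most [K i]. *)
destruct (ordinal_max k s (succ (K i)) Ok) as (z & Hz & Hsz & Hiz); auto.
{ now apply limit_succ; [| |apply K_in]. }
destruct (Hbe z Hz) as (y & Hy & HyX & Hyz); apply Hyz.
apply in_image in Hy; auto; destruct Hy as (j & Hj & ->).
assert (HjD := HeD j Hj); apply in_diagonal in HjD; auto; destruct HjD as [Hjt HjD].
destruct (proj2 Ot i j Hi Hjt) as [H|H].
- apply Hsz, Hsb; auto.
- apply Hiz, in_succ; [MM|].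
  assert (Hji : j ⊆ i).
  { destruct H as [->|H]; intros u Hu; [exact Hu|].
    apply ordinal_trans with j; auto; now apply ordinal_mem with t. }
  apply ordinal_subset; try (apply ordinal_mem with k; auto; fail).
  apply (K_mono_subset t K); auto.
Qed.

(** * Countable cofinality *)

Lemma succ_inj a b : M a -> M b -> ordinal a -> ordinal b -> succ a = succ b -> a = b.
Proof.
intros Ma Mb Oa Ob H; rewrite <- (Union_succ a), <- (Union_succ b), H; auto.
Qed.

Lemma succ_not_empty a : M a -> succ a <> emptyset.
Proof. intros Ma H; apply (in_empty a); rewrite <- H; apply in_succ; auto. Qed.

Section Pairing.

Variable w : U.
Hypotheses (Mw : M w) (Ow : is_omega w).

Fixpoint numeral (n : nat) : U :=
  match n with O => emptyset | S m => succ (numeral m) end.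

Lemma numeral_in n : numeral n ∈ w.
Proof.
induction n as [|n IH]; simpl; [apply empty_in_limit, Ow|].
now apply limit_succ; [apply Ow| |].
Qed.

(** Well-foundedness makes omega standard, so claims about it can be proved by arithmetic on
    [nat]. *)
Lemma numeral_onto x : x ∈ w -> exists n, x = numeral n.
Proof.
revert x; apply (omega_ind w (fun x => exists n, x = numeral n)); auto; [now exists O|].
intros n _ (m & ->); now exists (S m).
Qed.

(* Enumerates the diagonals a + b = constant one after the other. *)
Lemma pairing : exists q, term_fun q /\
  forall a b, a ∈ w -> b ∈ w -> exists l, l ∈ w /\ q l = pr a b.
Proof.
pose proof M_empty as M0.
assert (Ow' : ordinal w) by apply Ow.
(* One move along a diagonal: (c + 1, b) goes to (c, b + 1), and (0, b) to (b + 1, 0), the start of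
   the next diagonal. *)
pose (step := fun p => the (fun y => exists a, a ∈ w /\ exists b, b ∈ w /\
   (p = pr a b /\ ((a = emptyset /\ y = pr (succ b) emptyset) \/
     exists c, c ∈ w /\ (a = succ c /\ y = pr c (succ b)))))).
assert (U1 : forall p y y' : U,
  (exists a, a ∈ w /\ exists b, b ∈ w /\
   (p = pr a b /\ ((a = emptyset /\ y = pr (succ b) emptyset) \/
     exists c, c ∈ w /\ (a = succ c /\ y = pr c (succ b))))) ->
  (exists a, a ∈ w /\ exists b, b ∈ w /\
   (p = pr a b /\ ((a = emptyset /\ y' = pr (succ b) emptyset) \/
     exists c, c ∈ w /\ (a = succ c /\ y' = pr c (succ b))))) -> y = y').
{ intros p y y' (a & Ha & b & Hb & -> & H) (a' & Ha' & b' & Hb' & E & H').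
  apply pr_inj in E; try solve_M; destruct E as [<- <-].
  destruct H as [[E ->]|(c & Hc & E & ->)], H' as [[E' ->]|(c' & Hc' & E' & ->)]; auto.
  - destruct (succ_not_empty c'); [solve_M|congruence].
  - destruct (succ_not_empty c); [solve_M|congruence].
  - f_equal; apply succ_inj; try solve_M; try congruence; now apply ordinal_mem with w. }
assert (Ts : term_fun step).
{ apply (term_the (fun y p => exists a, a ∈ w /\ exists b, b ∈ w /\
   (p 0 = pr a b /\ ((a = emptyset /\ y = pr (succ b) emptyset) \/
     exists c, c ∈ w /\ (a = succ c /\ y = pr c (succ b)))))).
  - intros e y y' _ _ _; apply U1.
  - dfn. }
assert (Mn : forall n, M (numeral n)) by (intros n; apply M_mem with w; [exact Mw|apply numeral_in]).
destruct (iteration step (pr emptyset emptyset) Ts) as (q & Tq & q0 & qS); [solve_M|].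
exists q; split; [exact Tq|].
assert (qS' : forall l, l ∈ w -> q (succ l) = step (q l)).
{ intros l Hl; apply qS; [now apply ordinal_mem with w|solve_M]. }
pose (hit := fun a b => exists l, l ∈ w /\ q l = pr (numeral a) (numeral b)).
assert (hS : forall a b, hit (S a) b -> hit a (S b)).
{ intros a b (l & Hl & E); exists (succ l); split; [now apply limit_succ; [apply Ow| |]|].
  rewrite qS', E by exact Hl.
  assert (H : exists a', a' ∈ w /\ exists b', b' ∈ w /\
   (pr (numeral (S a)) (numeral b) = pr a' b' /\ ((a' = emptyset /\ pr (numeral a) (numeral (S b)) = pr (succ b') emptyset) \/
     exists c, c ∈ w /\ (a' = succ c /\ pr (numeral a) (numeral (S b)) = pr c (succ b'))))).
  { exists (numeral (S a)); split; [apply numeral_in|]; exists (numeral b).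
    split; [apply numeral_in|split; [reflexivity|right]].
    exists (numeral a); split; [apply numeral_in|auto]. }
  apply the_eq; [apply M_pr; apply Mn|exact H|]; intros y' _ Hy'; exact (U1 _ _ _ Hy' H). }
assert (h0 : forall b, hit 0 b -> hit (S b) 0).
{ intros b (l & Hl & E); exists (succ l); split; [now apply limit_succ; [apply Ow| |]|].
  rewrite qS', E by exact Hl.
  assert (H : exists a', a' ∈ w /\ exists b', b' ∈ w /\
   (pr (numeral 0) (numeral b) = pr a' b' /\ ((a' = emptyset /\ pr (numeral (S b)) (numeral 0) = pr (succ b') emptyset) \/
     exists c, c ∈ w /\ (a' = succ c /\ pr (numeral (S b)) (numeral 0) = pr c (succ b'))))).
  { exists (numeral 0); split; [apply numeral_in|]; exists (numeral b).
    split; [apply numeral_in|split; [reflexivity|left; auto]]. }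
  apply the_eq; [apply M_pr; apply Mn|exact H|]; intros y' _ Hy'; exact (U1 _ _ _ Hy' H). }
(* Here [s] numbers the diagonal and [j] the position on it. *)
assert (hs : forall s j, j <= s -> hit (s - j) j).
{ induction s as [|s IHs]; intros j Hj.
  - replace j with 0 by lia; exists emptyset; split; [apply (numeral_in 0)|exact q0].
  - induction j as [|j IHj].
    + apply h0; specialize (IHs s (le_n s)); now rewrite Nat.sub_diag in IHs.
    + apply hS; replace (S (S s - S j)) with (S s - j) by lia; apply IHj; lia. }
intros a b Ha Hb; destruct (numeral_onto a Ha) as (m & ->), (numeral_onto b Hb) as (n & ->).
specialize (hs (m + n) n); replace (m + n - n) with m in hs by lia; apply hs; lia.
Qed.

End Pairing.

(** * The closure X of a cofinal sequence and its coding by subsets of omega *)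

Section Countable.

Variables (k w Ks : U) (q kf bad : U -> U).
Hypotheses (Mk : M k) (Mw : M w) (MKs : M Ks) (Lk : limit_ordinal k) (Ow : is_omega w).
Hypothesis Ks_club : forall c, c ∈ Ks -> club k c.
Hypothesis term_q : term_fun q.
Hypothesis q_onto : forall a b, a ∈ w -> b ∈ w -> exists l, l ∈ w /\ q l = pr a b.
Hypotheses (term_kf : term_fun kf) (kf_in : forall n, n ∈ w -> kf n ∈ k).
Hypothesis kf_cof : forall x, x ∈ k -> exists n, n ∈ w /\ ~ kf n ∈ x.
Hypotheses (term_bad : term_fun bad) (bad_in : forall C, C ∈ Pow k -> bad C ∈ Ks).
Hypothesis bad_spec : forall C, C ∈ Pow k -> (forall x, x ∈ k -> exists y, y ∈ C /\ ~ y ∈ x) ->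
  forall x, x ∈ k -> exists y, y ∈ C /\ (~ y ∈ bad C /\ ~ y ∈ x).

Let Ok : ordinal k := proj1 Lk.

Definition below (C a : U) : U := Union (sep (bad C) (fun x => x ∈ a)).

(* The sequence of subsets of [w] coded by [c]. *)
Definition slice (c m : U) : U := sep w (fun i => exists l, l ∈ w /\ (succ l ∈ c /\ q l = pr m i)).

Definition img (s : U) : U := image (ap s) w.

Lemma term_below t s : definable_term t -> definable_term s ->
  definable_term (fun e => below (t e) (s e)).
Proof.
intros Ht Hs; unfold below; apply term_Union, term_sep; [now dfn|].
dfn; exact (term_shift _ Hs).
Qed.

Lemma term_slice t s : definable_term t -> definable_term s ->
  definable_term (fun e => slice (t e) (s e)).
Proof.
intros Ht Hs; unfold slice; apply term_sep; [now dfn|].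
dfn; [exact (term_shift _ (term_shift _ Ht))|exact (term_shift _ (term_shift _ Hs))].
Qed.

Lemma term_img : term_fun img.
Proof.
apply (term_mk (fun y e => exists m, m ∈ w /\ y = ap (e 0) m)); [|dfn].
intros e He; apply is_set_image; [exact Mw|]; apply term_ap, He.
Qed.

Ltac countable_rule u :=
  match goal with
  | |- definable_term (fun e => below _ _) => apply term_below
  | |- definable_term (fun e => slice _ _) => apply term_slice
  | |- definable_term (fun e => img _) => apply (term_app img _ term_img)
  | |- _ => fun_rule u
  end.
Ltac dfn2 := pose proof M_empty; repeat dfn_step countable_rule.

Lemma in_below C a z : M C -> M a ->
  (z ∈ below C a <-> exists x, x ∈ bad C /\ x ∈ a /\ z ∈ x).
Proof.
intros MC Ma; assert (Mb : M (bad C)) by MM.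
assert (D : definable (fun e => e 0 ∈ a)) by dfn.
unfold below; rewrite in_Union by (now apply M_sep); split.
- intros (x & Hx & Hz); apply in_sep in Hx; auto; exists x; tauto.
- intros (x & Hx & Hxa & Hz); exists x; split; [apply in_sep; auto|exact Hz].
Qed.

Lemma below_ordinal C a : C ∈ Pow k -> a ∈ k -> ordinal (below C a) /\ below C a ⊆ a.
Proof.
intros HC Ha; assert (MC : M C) by solve_M; assert (Ma : M a) by solve_M.
assert (Oa : ordinal a) by now apply ordinal_mem with k.
assert (D : definable (fun e => e 0 ∈ a)) by dfn.
split.
- apply ordinal_Union; [apply M_sep; [MM|exact D]|].
  intros x Hx; apply in_sep in Hx; [|MM|exact D]; now apply ordinal_mem with a.
- intros z Hz; apply in_below in Hz; auto; destruct Hz as (x & _ & Hx & Hz).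
  now apply ordinal_trans with x.
Qed.

Lemma below_in C a : C ∈ Pow k -> a ∈ k -> below C a ∈ k.
Proof.
intros HC Ha; destruct (below_ordinal C a HC Ha); now apply ordinal_subset_mem with a.
Qed.

Lemma in_slice c m i : M c -> M m ->
  (i ∈ slice c m <-> i ∈ w /\ exists l, l ∈ w /\ (succ l ∈ c /\ q l = pr m i)).
Proof. intros Mc Mm; apply in_sep; [exact Mw|dfn]. Qed.

Lemma M_slice c m : M c -> M m -> M (slice c m).
Proof. intros Mc Mm; apply M_sep; [exact Mw|dfn]. Qed.

Lemma in_img s y : M s -> (y ∈ img s <-> exists m, m ∈ w /\ y = ap s m).
Proof. intros Ms; apply in_image; [exact Mw|now apply term_ap]. Qed.

(** The sequence [s] carries both arguments of the closure operation: its range is the countable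
    set, its first entry the ordinal below which the supremum is taken. *)
Definition value (s : U) : U := below (img s) (ap s emptyset).

(* The least closed relation [R] is a partial map of P([w]) onto [X]: its functionality
   bounds the size of [X] by that of P([w]) without an iteration of length omega_1.
   Codes of the first kind are singletons {n + 1}, those of the second contain 0. *)
Definition closed_rel (r : U) : Prop :=
  (forall n, n ∈ w -> pr (upair (succ n) (succ n)) (kf n) ∈ r) /\
  forall c, c ∈ Pow w -> emptyset ∈ c -> forall s, M s ->
    (forall m, m ∈ w -> pr (slice c m) (ap s m) ∈ r) -> pr c (value s) ∈ r.

Definition prod (a b : U) : U := mk (fun p => exists x, x ∈ a /\ exists y, y ∈ b /\ p = pr x y).

Lemma is_set_prod a b : M a -> M b ->
  is_set (fun p => exists x, x ∈ a /\ exists y, y ∈ b /\ p = pr x y).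
Proof.
intros Ma Mb.
pose (row := fun x => mk (fun p => exists y, y ∈ b /\ p = pr x y)).
assert (Hrow : forall x, M x -> is_set (fun p => exists y, y ∈ b /\ p = pr x y)).
{ intros x Mx; apply (is_set_image b (fun y => pr x y) Mb); dfn. }
assert (Tr : term_fun row).
{ apply (term_mk (fun p e => exists y, y ∈ b /\ p = pr (e 0) y)); [|dfn].
  intros e He; apply Hrow, He. }
apply is_set_ext with (fun z => exists y, y ∈ image row a /\ z ∈ y).
- intros z; split.
  + intros (y & Hy & Hz); apply in_image in Hy; auto; destruct Hy as (x & Hx & ->).
    exists x; split; [exact Hx|]; unfold row in Hz.
    apply (in_mk (fun p => exists y, y ∈ b /\ p = pr x y)) in Hz; auto; apply Hrow; solve_M.
  + intros (x & Hx & H); exists (row x); split; [apply in_image; eauto|].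
    apply (in_mk (fun p => exists y, y ∈ b /\ p = pr x y)); auto; apply Hrow; solve_M.
- apply is_set_union; now apply M_image.
Qed.

Lemma pr_in_prod a b x y : M a -> M b -> M x -> M y -> (pr x y ∈ prod a b <-> x ∈ a /\ y ∈ b).
Proof.
intros Ma Mb Mx My; unfold prod.
rewrite (in_mk (fun p => exists x, x ∈ a /\ exists y, y ∈ b /\ p = pr x y))
  by (now apply is_set_prod).
split; [|intros [Hx Hy]; eauto].
intros (x' & Hx & y' & Hy & E); apply pr_inj in E; try solve_M; destruct E; subst; auto.
Qed.

Let W : U := prod (Pow w) k.

Lemma M_W : M W.
Proof. apply M_mk, is_set_prod; solve_M. Qed.

Definition R : U := sep W (fun p => forall r, M r -> closed_rel r -> p ∈ r).

Lemma definable_closed_rel : definable (fun e => closed_rel (e 0)).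
Proof. unfold closed_rel, value; dfn2. Qed.

Lemma in_R p : p ∈ R <-> p ∈ W /\ forall r, M r -> closed_rel r -> p ∈ r.
Proof.
apply in_sep; [exact M_W|]; pose proof definable_closed_rel; dfn2.
Qed.

Lemma M_R : M R.
Proof. apply M_sep; [exact M_W|]; pose proof definable_closed_rel; dfn2. Qed.

Lemma M_value s : M s -> M (value s).
Proof.
intros Ms; apply (M_fun value s); [|exact Ms]; unfold value, term_fun; dfn2.
Qed.

Lemma closed_rel_R : closed_rel R.
Proof.
pose proof M_empty as M0; pose proof M_W as MW.
assert (H0 : emptyset ∈ w) by apply empty_in_limit, Ow.
split.
- intros n Hn; assert (Mn : M n) by solve_M; assert (Mf : M (kf n)) by MM.
  apply in_R; split; [|intros r Mr [Hr _]; auto].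
  apply pr_in_prod; try solve_M; split; [|auto].
  apply in_Pow; [exact Mw|]; split; [solve_M|]; intros z Hz.
  apply in_upair in Hz; try solve_M.
  assert (z = succ n) as -> by tauto; now apply limit_succ; [apply Ow| |].
- intros c Hc Hc0 s Ms H; assert (Mc : M c) by solve_M.
  assert (Ta := term_ap s Ms).
  assert (Hs : forall m, m ∈ w -> ap s m ∈ k).
  { intros m Hm; specialize (H m Hm); apply in_R in H; destruct H as [H _].
    apply pr_in_prod in H; try solve_M; [tauto|apply M_slice; solve_M|MM]. }
  apply in_R; split.
  + pose proof (M_value s Ms); apply pr_in_prod; try solve_M; split; [exact Hc|].
    apply below_in; auto; apply in_Pow; [exact Mk|]; split.
    * apply M_image; auto.
    * intros z Hz; apply in_img in Hz; auto; destruct Hz as (m & Hm & ->); auto.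
  + intros r Mr Cr; apply Cr; auto; intros m Hm; specialize (H m Hm).
    apply in_R in H; now apply H.
Qed.

Lemma R_min r : M r -> closed_rel r -> R ⊆ r.
Proof. intros Mr Cr p Hp; apply in_R in Hp; now apply Hp. Qed.

Definition derived (p : U) : Prop :=
  (exists n, n ∈ w /\ p = pr (upair (succ n) (succ n)) (kf n)) \/
  exists c, c ∈ Pow w /\ (emptyset ∈ c /\ exists s, M s /\
    ((forall m, m ∈ w -> pr (slice c m) (ap s m) ∈ R) /\ p = pr c (value s))).

(** By leastness of [R]: discarding the pairs that no rule produces leaves a closed relation. *)
Lemma R_inv p : p ∈ R -> derived p.
Proof.
pose proof M_R as MR; assert (D : definable (fun e => derived (e 0))).
{ unfold derived, value; dfn2. }
destruct closed_rel_R as [R1 R2]; intros Hp.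
apply (R_min (sep R derived)) in Hp; [now apply in_sep in Hp|now apply M_sep|].
split.
- intros n Hn; apply in_sep; auto; split; [auto|left; eauto].
- intros c Hc H0 s Ms H.
  assert (H' : forall m, m ∈ w -> pr (slice c m) (ap s m) ∈ R).
  { intros m Hm; specialize (H m Hm); now apply in_sep in H. }
  apply in_sep; auto; split; [auto|right; exists c; eauto 8].
Qed.

(** By leastness of [R], as the pairs whose code has one value form a closed relation. Membership of
    0 separates the two kinds of codes; a singleton determines [n], and a code of the second kind
    determines, by the induction hypothesis on its slices, every entry of [s] and so [value s]. *)
Lemma R_fun c x y : M c -> M x -> M y -> pr c x ∈ R -> pr c y ∈ R -> x = y.
Proof.
pose proof M_R as MR; pose proof M_empty as M0; intros Mc Mx My Hx Hy.
pose (P := fun p => forall c, M c -> forall x, M x -> p = pr c x ->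
   forall y, M y -> pr c y ∈ R -> x = y).
assert (D : definable (fun e => P (e 0))) by (unfold P; dfn2).
destruct closed_rel_R as [R1 R2].
assert (N0 : forall n, n ∈ w -> ~ emptyset ∈ upair (succ n) (succ n)).
{ intros n Hn H; assert (Mn : M n) by solve_M; apply in_upair in H; try solve_M.
  apply (succ_not_empty n Mn); intuition congruence. }
apply (R_min (sep R P)) in Hx; [apply in_sep in Hx; auto; now apply (proj2 Hx c Mc x)|now apply M_sep|].
clear c x y Mc Mx My Hx Hy; split.
- intros n Hn; assert (Mn : M n) by solve_M; assert (Mf : M (kf n)) by MM.
  apply in_sep; auto; split; [auto|].
  intros c Mc x Mx E y My Hy; apply pr_inj in E; try solve_M; destruct E as [<- <-].
  destruct (R_inv _ Hy) as [(n' & Hn' & E)|(c & Hc & Hc0 & s & Ms & _ & E)].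
  + assert (Mn' : M n') by solve_M; assert (Mf' : M (kf n')) by MM.
    apply pr_inj in E; try solve_M; destruct E as [E ->].
    f_equal; apply succ_inj; auto; try (apply ordinal_mem with w; auto; apply Ow).
    apply upair_inj1 in E; try solve_M; tauto.
  + pose proof (M_value s Ms); assert (Mc' : M c) by solve_M.
    apply pr_inj in E; try solve_M; destruct E as [<- _]; now destruct (N0 n Hn).
- intros c Hc Hc0 s Ms H; assert (Mc : M c) by solve_M; pose proof (M_value s Ms) as Mv.
  assert (Ta := term_ap s Ms).
  assert (HR : forall m, m ∈ w -> pr (slice c m) (ap s m) ∈ R).
  { intros m Hm; specialize (H m Hm); now apply in_sep in H. }
  apply in_sep; auto; split; [auto|].
  intros c' Mc' x Mx E y My Hy; apply pr_inj in E; try solve_M; destruct E as [<- <-].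
  destruct (R_inv _ Hy) as [(n & Hn & E)|(c' & Hc' & Hc0' & s' & Ms' & HR' & E)].
  + assert (Mn : M n) by solve_M; assert (Mf : M (kf n)) by MM.
    apply pr_inj in E; try solve_M; destruct E as [-> _]; now destruct (N0 n Hn).
  + pose proof (M_value s' Ms') as Mv'; assert (Mcc : M c') by solve_M.
    apply pr_inj in E; try solve_M; destruct E as [<- ->].
    assert (Ta' := term_ap s' Ms').
    assert (Es : forall m, m ∈ w -> ap s m = ap s' m).
    { intros m Hm; assert (Mm : M m) by solve_M; specialize (H m Hm).
      apply in_sep in H; auto; destruct H as [_ H].
      apply (H (slice c m) (M_slice c m Mc Mm) (ap s m)); auto; MM. }
    unfold value; rewrite Es by apply empty_in_limit, Ow.
    replace (img s) with (img s'); [reflexivity|].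
    apply mem_ext; intros z; rewrite !in_img by assumption.
    split; intros (m & Hm & ->); exists m; split; auto; symmetry; auto.
Qed.

Definition X : U := sep k (fun x => exists c, c ∈ Pow w /\ pr c x ∈ R).

Lemma in_X x : x ∈ X <-> x ∈ k /\ exists c, c ∈ Pow w /\ pr c x ∈ R.
Proof. pose proof M_R; apply in_sep; [exact Mk|dfn2]. Qed.

Lemma M_X : M X.
Proof. pose proof M_R; apply M_sep; [exact Mk|dfn2]. Qed.

(** The set of values of the slices of [c]. Being defined for every [c], it lets [Pow w] index all
    ranges of sequences in X. *)
Definition decode (c : U) : U := sep k (fun x => exists m, m ∈ w /\ pr (slice c m) x ∈ R).

Lemma term_decode : term_fun decode.
Proof.
pose proof M_R; apply (term_sep (fun _ => k) (fun x e => exists m, m ∈ w /\ pr (slice (e 0) m) x ∈ R)); dfn2.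
Qed.

Lemma in_decode c x : M c -> (x ∈ decode c <-> x ∈ k /\ exists m, m ∈ w /\ pr (slice c m) x ∈ R).
Proof. intros Mc; pose proof M_R; apply in_sep; [exact Mk|dfn2]. Qed.

Lemma kf_in_X n : n ∈ w -> kf n ∈ X.
Proof.
intros Hn; apply in_X; split; [auto|].
assert (Mn : M n) by solve_M.
exists (upair (succ n) (succ n)); split; [|now apply closed_rel_R].
apply in_Pow; [exact Mw|]; split; [solve_M|]; intros z Hz.
apply in_upair in Hz; try solve_M.
assert (z = succ n) as -> by tauto; now apply limit_succ; [apply Ow| |].
Qed.

(** Choose a code [D m] for each [F m] and fold these into one [c]. The same [c] codes the supremum
    and, through [decode], the range of [F]. *)
Lemma X_closed F : term_fun F -> (forall m, m ∈ w -> F m ∈ X) ->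
  below (image F w) (F emptyset) ∈ X /\ exists c, c ∈ Pow w /\ decode c = image F w.
Proof.
intros TF HF; pose proof M_R as MR; pose proof M_X as MX; pose proof M_empty as M0.
assert (Lw := proj1 Ow).
assert (H0 : emptyset ∈ w) by now apply empty_in_limit.
destruct (choice w (Pow w) (fun m d => pr d (F m) ∈ R)) as (D & TD & HD); auto.
{ solve_M. }
{ dfn2. }
{ intros m Hm; specialize (HF m Hm); apply in_X in HF; apply HF. }
assert (HDw : forall m, m ∈ w -> D m ⊆ w).
{ intros m Hm; destruct (HD m Hm) as [H _]; apply in_Pow in H; auto; apply H. }
(* The member 0 marks the second kind; a pair (m, i) with [i] in [D m] is stored as the successor of
   its indices under [q], which keeps 0 free. A pair with several indices does no harm. *)
pose (c := sep w (fun z => z = emptyset \/ exists l, l ∈ w /\ (z = succ l /\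
  exists m, m ∈ w /\ exists i, i ∈ D m /\ q l = pr m i))).
assert (Dc : definable (fun e => e 0 = emptyset \/ exists l, l ∈ w /\ (e 0 = succ l /\
  exists m, m ∈ w /\ exists i, i ∈ D m /\ q l = pr m i))) by dfn2.
assert (Mc : M c) by (apply M_sep; auto).
assert (Hc : c ∈ Pow w).
{ apply in_Pow; auto; split; [exact Mc|]; intros z Hz; now apply in_sep in Hz. }
assert (Hslice : forall m, m ∈ w -> slice c m = D m).
{ intros m Hm; assert (Mm : M m) by solve_M; apply mem_ext; intros i.
  rewrite in_slice by assumption; split.
  - intros (Hi & l & Hl & Hlc & E); assert (Ml : M l) by solve_M.
    apply in_sep in Hlc; auto; destruct Hlc as [_ [E0|(l' & Hl' & E0 & m' & Hm' & i' & Hi' & E')]].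
    + now destruct (succ_not_empty l Ml).
    + apply succ_inj in E0; [subst l'|solve_M..|now apply ordinal_mem with w; [apply Lw|]|
        now apply ordinal_mem with w; [apply Lw|]].
      assert (HiD := HDw m' Hm' i' Hi').
      rewrite E in E'; apply pr_inj in E'; try solve_M; destruct E'; subst; auto.
  - intros Hi; assert (Hiw := HDw m Hm i Hi); split; [exact Hiw|].
    destruct (q_onto m i Hm Hiw) as (l & Hl & E); exists l; split; [exact Hl|split; [|exact E]].
    apply in_sep; auto; split; [now apply limit_succ|right].
    exists l; split; [exact Hl|split; [reflexivity|eauto]]. }
assert (Hc0 : emptyset ∈ c) by (apply in_sep; auto).
assert (Ml : M (lam w F)) by now apply M_lam.
assert (Eap : forall m, m ∈ w -> ap (lam w F) m = F m) by (intros; now apply ap_lam).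
assert (Eimg : img (lam w F) = image F w).
{ apply mem_ext; intros z; rewrite in_img, in_image by assumption.
  split; intros (m & Hm & ->); exists m; split; auto; symmetry; auto. }
split.
- assert (Hv : pr c (value (lam w F)) ∈ R).
  { apply closed_rel_R; auto; intros m Hm; rewrite Hslice, Eap by exact Hm; now apply HD. }
  unfold value in Hv; rewrite Eimg, Eap in Hv by exact H0.
  apply in_X; split; [|eauto].
  apply below_in; [|now apply in_X, HF].
  apply in_Pow; auto; split; [now apply M_image|].
  intros z Hz; apply in_image in Hz; auto; destruct Hz as (m & Hm & ->); now apply in_X, HF.
- exists c; split; [exact Hc|]; apply mem_ext; intros x; rewrite in_decode, in_image by assumption.
  split.
  + intros (Hx & m & Hm & H); exists m; split; [exact Hm|]; rewrite Hslice in H by exact Hm.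
    apply (R_fun (D m)); auto; try solve_M; try MM; now apply HD.
  + intros (m & Hm & ->); split; [now apply in_X, HF|].
    exists m; split; [exact Hm|]; rewrite Hslice by exact Hm; now apply HD.
Qed.

(* Each [F n] is the least element of [X] above a point of [E]; were it outside
   [bad C] for [C] the range of [F], the supremum of [bad C] below [F n] would be
   a smaller such element. *)
Lemma no_lower_bound E : E ∈ Ks ->
  ~ forall c, c ∈ Pow w -> exists s, s ∈ k /\ forall y, y ∈ E -> ~ y ∈ bad (decode c) -> y ∈ s.
Proof.
intros HE low; pose proof M_X as MX; pose proof M_empty as M0.
assert (ME : M E) by solve_M.
assert (HEk : forall x, x ∈ E -> x ∈ k) by (intros x Hx; now apply (Ks_club E HE)).
assert (HXk : forall x, x ∈ X -> x ∈ k) by (intros x Hx; now apply in_X).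
assert (Oel : forall x, x ∈ k -> ordinal x) by (intros x Hx; now apply ordinal_mem with k).
destruct (choice w X (fun n y => exists g, g ∈ E /\ (~ g ∈ kf n /\ (~ y ∈ g /\
   forall x, x ∈ X -> ~ x ∈ g -> ~ x ∈ y)))) as (F & TF & HF); auto.
{ dfn2. }
{ intros n Hn; destruct (proj1 (proj2 (Ks_club E HE)) (kf n) (kf_in n Hn)) as (g & Hg & Hgn).
  destruct (kf_cof g (HEk g Hg)) as (m & Hm & Hmg).
  destruct (least (fun y => y ∈ X /\ ~ y ∈ g) (kf m)) as (y & [Hy Hyg] & Ly).
  { split; [now apply kf_in_X|exact Hmg]. }
  exists y; split; [exact Hy|]; exists g; split; [exact Hg|split; [exact Hgn|split; [exact Hyg|]]].
  intros x Hx Hxg Hxy; exact (Ly x Hxy (conj Hx Hxg)). }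
destruct (X_closed F TF) as (_ & c & Hc & Edec); [intros m Hm; now apply HF|].
set (C := image F w) in *.
assert (MC : M C) by (now apply M_image).
assert (HC : forall y, y ∈ C <-> exists n, n ∈ w /\ y = F n) by (intros; now apply in_image).
assert (HCX : forall y, y ∈ C -> y ∈ X).
{ intros y Hy; apply HC in Hy; destruct Hy as (n & Hn & ->); now apply HF. }
assert (HCk : C ∈ Pow k) by (apply in_Pow; auto; split; [exact MC|]; intros y Hy; auto).
destruct (low c Hc) as (s & Hs & Hlow); rewrite Edec in Hlow.
(* The threshold [b1] is a point of X not below [s]. If [y] exceeds it, then its [g] is not below
   [s]: otherwise [b1] would be a smaller element of X above [g]. So [g] is in [bad C]. *)
destruct (kf_cof s Hs) as (n1 & Hn1 & Hs1); set (b1 := kf n1) in *.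
assert (Hb1 : b1 ∈ X) by now apply kf_in_X.
assert (Mb1 : M b1) by solve_M.
destruct (bad_spec C HCk) with (x := succ b1) as (y & Hy & Hybad & Hyb).
{ intros x Hx; destruct (kf_cof x Hx) as (n & Hn & Hnx).
  destruct (HF n Hn) as (HFn & g & Hg & Hgn & Hyg & _).
  exists (F n); split; [apply HC; eauto|]; intros H; apply Hnx.
  assert (H1 : kf n ⊆ g) by (apply ordinal_nmem_subset; auto).
  assert (H2 : g ⊆ F n) by (apply ordinal_nmem_subset; auto).
  apply ordinal_subset_mem with (F n); auto; intros z Hz; auto. }
{ apply limit_succ; auto. }
assert (HyC := Hy); apply HC in Hy; destruct Hy as (n & Hn & Ey).
destruct (HF n Hn) as (HyX & g & Hg & Hgn & Hyg & Hmin); rewrite <- Ey in *.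
assert (Hyk : y ∈ k) by auto.
assert (Hb1y : b1 ∈ y).
{ apply (ordinal_nmem_subset y (succ b1)); auto; [apply ordinal_succ; auto|apply in_succ; auto]. }
assert (Hgs : ~ g ∈ s).
{ intros H; apply (Hmin b1 Hb1); [|exact Hb1y]; apply mem_asym.
  revert H; apply ordinal_nmem_subset; auto. }
assert (Hgbad : g ∈ bad C) by (apply NNPP; intros H; apply Hgs; auto).
assert (Hgy : g ∈ y).
{ destruct (ordinal_nmem y g) as [H| ->]; auto; tauto. }
assert (My : M y) by solve_M.
(* [F] with [y] put in front: the range is unchanged, but the closure operation now takes the
   supremum below [y]. *)
pose (F' := fun m => the (fun z => (m = emptyset /\ z = y) \/ (~ m = emptyset /\ z = F (Union m)))).
assert (TF' : term_fun F').
{ apply (term_the (fun z m => (m 0 = emptyset /\ z = y) \/ (~ m 0 = emptyset /\ z = F (Union (m 0))))).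
  - intros e z z' _ _ _ H1 H2; intuition congruence.
  - dfn2. }
assert (F'0 : F' emptyset = y) by (apply the_eq; auto; intros z _ H; tauto).
assert (F'S : forall m, m ∈ w -> F' (succ m) = F m).
{ intros m Hm; assert (Mm : M m) by solve_M; pose proof (succ_not_empty m Mm).
  unfold F'; rewrite Union_succ; [|exact Mm|apply ordinal_mem with w; [apply Ow|exact Hm]].
  apply the_eq; [MM|auto|]; intros z _ Hz; tauto. }
assert (F'C : forall m, m ∈ w -> F' m ∈ C).
{ apply omega_ind; auto; [now rewrite F'0|].
  intros m Hm _; rewrite F'S by exact Hm; apply HC; eauto. }
assert (EC : image F' w = C).
{ apply mem_ext; intros z; rewrite in_image by assumption; split.
  - intros (m & Hm & ->); auto.
  - intros Hz; apply HC in Hz; destruct Hz as (m & Hm & ->).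
    exists (succ m); split; [now apply limit_succ; [apply Ow| |]|now rewrite F'S]. }
destruct (X_closed F' TF') as [Hsup _]; [intros m Hm; auto|].
rewrite EC, F'0 in Hsup.
destruct (below_ordinal C y HCk Hyk) as [Ob Hby].
(* The supremum is in X and not below [g], because [g] is a point of [bad C] under [y]; were it
   smaller than [y], minimality of [y] would fail. *)
assert (Eb : below C y = y).
{ destruct (ordinal_subset (below C y) y) as [H|H]; auto; exfalso.
  apply (Hmin (below C y)); auto; apply ordinal_subset_nmem.
  intros z Hz; apply in_below; auto; eauto. }
apply Hybad, closed_sup with k; auto.
- eauto.
- intros z Hz; rewrite <- Eb in Hz; apply in_below in Hz; auto.
  destruct Hz as (x & Hx & Hxy & Hzx); eauto.
Qed.

End Countable.

(** The covering hypothesis is phrased for families indexed by [Pow w], which is how [decode]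
    presents the countable subsets of X. *)
Lemma countable_case k w Ks : M k -> M w -> limit_ordinal k -> cofinality M k w ->
  is_omega w -> M Ks -> (forall c, c ∈ Ks -> club k c) ->
  (forall H, term_fun H -> (forall c, c ∈ Pow w -> H c ∈ Ks) ->
     exists E, E ∈ Ks /\ forall c, c ∈ Pow w ->
       exists s, s ∈ k /\ forall y, y ∈ E -> ~ y ∈ H c -> y ∈ s) ->
  exists C, M C /\ C ⊆ k /\ unbounded k (fun x => x ∈ C) /\
    forall E, E ∈ Ks -> bounded k (fun x => x ∈ C /\ ~ x ∈ E).
Proof.
intros Mk Mw Lk cof Ow MKs HKs cover.
assert (cof' := cof); destruct cof' as (_ & _ & (f & Mf & [[Hf Hm] Hu]) & _).
pose proof (term_ap f Mf) as Tf.
destruct (pairing w Mw Ow) as (q & Tq & Hq).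
apply NNPP; intros N.
assert (N' : forall C, M C -> C ⊆ k -> unbounded k (fun x => x ∈ C) ->
  exists E, E ∈ Ks /\ forall x, x ∈ k -> exists y, y ∈ C /\ (~ y ∈ E /\ ~ y ∈ x)).
{ intros C MC HC UC; apply NNPP; intros N'; apply N; exists C.
  split; [exact MC|split; [exact HC|split; [exact UC|]]].
  intros E HE; apply NNPP; intros NE; apply N'; exists E; split; [exact HE|].
  intros x Hx; apply NNPP; intros Nx; apply NE; exists x; split; [exact Hx|].
  intros y [Hy HyE]; apply NNPP; intros Hyx; apply Nx; eauto. }
destruct (choice (Pow k) Ks (fun C E =>
   (forall x, x ∈ k -> exists y, y ∈ C /\ ~ y ∈ x) ->
   forall x, x ∈ k -> exists y, y ∈ C /\ (~ y ∈ E /\ ~ y ∈ x))) as (bad & Tbad & Hbad); auto.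
{ solve_M. }
{ dfn. }
{ intros C HC; apply in_Pow in HC; auto; destruct HC as [MC HC].
  destruct (classic (unbounded k (fun x => x ∈ C))) as [UC|UC].
  - destruct (N' C MC HC UC) as (E & HE & H); eauto.
  (* For a bounded [C] the relation asks nothing, yet a member of [Ks] is required; the one that is
     bad for [k] serves. *)
  - destruct (N' k Mk) as (E & HE & _).
    + intros z Hz; exact Hz.
    + apply club_full, Lk.
    + exists E; split; [exact HE|]; intros H; destruct (UC H). }
destruct (cover (fun c => bad (decode k w q (ap f) bad c))) as (E & HE & Hlow).
{ apply term_comp; [exact Tbad|]; now apply term_decode. }
{ intros c Hc; apply Hbad; assert (Mc : M c) by solve_M.
  apply in_Pow; auto; split.
  - apply M_fun; [now apply term_decode|exact Mc].
  - intros z Hz; now apply in_decode in Hz. }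
apply (no_lower_bound k w Ks q (ap f) bad) with (E := E); auto.
- intros n Hn; apply (Hm n); now apply function_ap with w.
- intros x Hx; destruct (Hu x Hx) as (y & (n & Hny) & Hy).
  apply (function_app f w) in Hny; auto; destruct Hny as [Hn ->]; eauto.
- intros C HC; now apply Hbad.
- intros C HC; now apply Hbad.
Qed.

(** * Transfer between the two models and conclusion *)

Lemma clubs_set k : M k -> exists Ks, M Ks /\ forall c, c ∈ Ks <-> M c /\ club k c.
Proof.
intros Mk; exists (sep (Pow k) (fun c => club k c)); split; [apply M_sep; [solve_M|dfn]|].
intros c; rewrite in_sep; [|solve_M|dfn]; rewrite in_Pow by exact Mk.
split; [tauto|]; intros [Mc Cc]; split; [split; [exact Mc|apply Cc]|exact Cc].
Qed.

Lemma two_power_card_le w m H : M w -> two_power M w m -> M m -> term_fun H ->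
  card_le M (image H (Pow w)) m.
Proof.
intros Mw (p & Mp & Hp & Cm & Em) Mm TH.
replace (Pow w) with p; [apply card_le_image; auto; apply Cm|].
apply mem_ext; intros z; rewrite in_Pow by exact Mw; split.
- intros Hz; assert (Mz : M z) by solve_M; split; [exact Mz|now apply Hp].
- intros [Mz Hz]; now apply Hp.
Qed.

End Model.

Theorem theorem2p2 :
  forall (U : universe) (V1 V2 : U -> Prop) (kappa theta : U),
    (* (i) *)
    transitive_class V1 -> transitive_class V2 ->
    ZFC V1 -> ZFC V2 ->
    class_of V2 V1 ->
    (forall x, V2 x -> ordinal x -> V1 x) ->
    (* (ii) *)
    V1 kappa -> regular V1 kappa -> gt_aleph0 kappa ->
    (* (iii) *)
    V2 theta -> cofinality V2 kappa theta -> cardinal V2 kappa -> theta ∈ kappa ->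
    (gt_aleph0 theta /\
     (* (iv') *)
     (forall mu a, V2 mu -> V2 a ->
        cf_Club V2 theta mu -> card_le V2 a mu ->
        (forall E, E ∈ a -> Club V1 kappa E) ->
        exists b, V2 b /\ function_on b theta /\
          (forall i bi, app b i bi -> V1 bi /\ card_le V1 bi kappa) /\
          (forall E, E ∈ a -> exists i bi, app b i bi /\ E ∈ bi)))
    \/
    (is_omega theta /\
     (* (iv'') *)
     (exists mu, V2 mu /\ two_power V2 theta mu /\ mu ∈ kappa) /\
     (* (v'') *)
     (forall mu a, V2 mu -> V2 a ->
        two_power V2 theta mu -> card_le V2 a mu ->
        (forall E, E ∈ a -> Club V1 kappa E) ->
        exists b, V1 b /\ a ⊆ b /\ card_le V1 b kappa)) ->
    exists C, V2 C /\ C ⊆ kappa /\ unbounded kappa (fun x => x ∈ C) /\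
      forall E, Club V1 kappa E ->
        bounded kappa (fun x => x ∈ C /\ x ∉ E).
Proof.
intros U V1 V2 k t T1 T2 Z1 Z2 [V12 _] _ K1 reg k_unc Mt cof _ _ H.
assert (Mk : V2 k) by auto; assert (Lk : limit_ordinal k) by apply reg.
destruct (clubs_set T1 Z1 k K1) as (Ks & K1s & HKs).
assert (KsClub : forall c, c ∈ Ks -> Club V1 k c).
{ intros c Hc; apply HKs in Hc; destruct Hc as [Mc Cc]; split; [exact Mc|split; [apply Cc|]].
  exists c; split; [exact Mc|split; [exact Cc|]]; intros z Hz; exact Hz. }
(* [b] and its injection into kappa lie in V1, where kappa is regular, so the diagonal intersection
   is formed there; the bounds it yields are absolute and carry over to V2. *)
assert (low : forall b, V1 b -> card_le V1 b k -> exists E, E ∈ Ks /\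
  forall X, X ∈ b -> X ∈ Ks -> exists s, s ∈ k /\ forall y, y ∈ E -> ~ y ∈ X -> y ∈ s).
{ intros b Mb Cb.
  destruct (almost_lower_bound T1 Z1 k b K1 reg k_unc Mb Cb) as (E & ME & CE & HE).
  exists E; split; [apply HKs; auto|]; intros X HX HXs; apply HE; auto; now apply HKs. }
assert (main : exists C, V2 C /\ C ⊆ k /\ unbounded k (fun x => x ∈ C) /\
  forall E, E ∈ Ks -> bounded k (fun x => x ∈ C /\ ~ x ∈ E)).
{ assert (HKs' : forall c, c ∈ Ks -> club k c) by (intros c Hc; now apply HKs).
  destruct H as [[t_unc cover]|[Ot [(mu & Mmu & Hmu & _) cover]]].
  - apply (uncountable_case T2 Z2 k t Ks); auto.
    intros mu a Mmu Ma Hmu Ca Ha.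
    destruct (cover mu a) as (b & Mb & Fb & Hb & Cov); auto.
    exists b; split; [exact Mb|split; [exact Fb|split; [|exact Cov]]].
    intros i B HB; destruct (Hb i B HB); auto.
  - apply (countable_case T2 Z2 k t Ks); auto.
    intros F TF HF.
    assert (MP : V2 (Pow Z2 t)) by now apply M_Pow.
    assert (HI : forall y, y ∈ image Z2 F (Pow Z2 t) <-> exists c, c ∈ Pow Z2 t /\ y = F c).
    { intros y; now apply in_image. }
    destruct (cover mu (image Z2 F (Pow Z2 t))) as (b & Mb & Hab & Cb); auto.
    + now apply M_image.
    + now apply two_power_card_le.
    + intros E HE; apply HI in HE; destruct HE as (c & Hc & ->); auto.
    + destruct (low b Mb Cb) as (E & HE & HX); exists E; split; [exact HE|].
      intros c Hc; apply HX; [|auto]; apply Hab, HI; eauto. }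
destruct main as (C & MC & HC & UC & almost).
exists C; split; [exact MC|split; [exact HC|split; [exact UC|]]].
(* A member of the filter includes a club of V1, and a point outside the member is outside this
   club, so the same bound works. *)
intros E (_ & _ & c & Mc & Cc & Hc).
destruct (almost c) as (s & Hs & Hb); [apply HKs; auto|].
exists s; split; [exact Hs|]; intros y [HyC HyE]; apply Hb; split; auto.
Qed.
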